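(* Let $d\ge 2$ be an integer, $\alpha>-\frac12$ a real number, and $1<p\le+\infty$. There exists a constant $c>0$, independent of $f$, such that for every $f\in L^p(\mathbb{R}^d_+,\nu_\alpha)$ one has $M_\alpha f\in L^p(\mathbb{R}^d_+,\nu_\alpha)$ and $$\|M_\alpha f\|_{p,\alpha}\le c\,\|f\|_{p,\alpha}.$$
   Context: $\mathbb{R}^d_+=\mathbb{R}^{d-1}\times(0,+\infty)$; points are written $x=(x',x_d)$ with $x'=(x_1,\dots,x_{d-1})\in\mathbb{R}^{d-1}$, $x_d>0$; $\|\cdot\|$ is the Euclidean norm. The measure $\nu_\alpha$ on $\mathbb{R}^d_+$ is $$d\nu_\alpha(x)=\frac{x_d^{2\alpha+1}}{(2\pi)^{\frac{d-1}{2}}2^\alpha\Gamma(\alpha+1)}\,dx,$$ where $dx$ is Lebesgue measure. For $1\le p<+\infty$, $\|f\|_{p,\alpha}=\big(\int_{\mathbb{R}^d_+}|f|^p\,d\nu_\alpha\big)^{1/p}$, and for $p=+\infty$, $\|f\|_{\infty,\alpha}=\|f\|_\infty$ is the essential supremum of $|f|$ on $\mathbb{R}^d_+$; $L^p(\mathbb{R}^d_+,\nu_\alpha)$ is the space of measurable functions with finite norm. For $\varepsilon>0$ and a point $x\in\mathbb{R}^d_+$ or $x=0$, $B^+(x,\varepsilon)=B(x,\varepsilon)\cap\mathbb{R}^d_+$, where $B(x,\varepsilon)$ is the closed Euclidean ball of $\mathbb{R}^d$ with center $x$ and radius $\varepsilon$; $\chi_A$ is the characteristic function of $A$. For $x_d,y_d,\rho>0$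 let $$W_\alpha(x_d,y_d,\rho)=\frac{\Gamma(\alpha+1)\,\big((x_d+y_d)^2-\rho^2\big)^{\alpha-\frac12}\big(\rho^2-(x_d-y_d)^2\big)^{\alpha-\frac12}}{2^{2\alpha-1}\sqrt{\pi}\,\Gamma(\alpha+\frac12)\,(x_dy_d\rho)^{2\alpha}}$$ if $|x_d-y_d|<\rho<x_d+y_d$, and $W_\alpha(x_d,y_d,\rho)=0$ otherwise. The Weinstein translation of $\chi_{B^+(0,\varepsilon)}$ by $x\in\mathbb{R}^d_+$ is given, for $y=(y',y_d)\in\mathbb{R}^d_+$, by $$\tau_x(\chi_{B^+(0,\varepsilon)})(-y',y_d)=\int_0^{+\infty}\chi_{B^+(0,\varepsilon)}(x'-y',\rho)\,W_\alpha(x_d,y_d,\rho)\,\rho^{2\alpha+1}\,d\rho.$$ The uncentered maximal function of $f$ is, for $x\in\mathbb{R}^d_+$, $$M_\alpha f(x)=\sup_{\varepsilon>0,\;z\in B^+(x,\varepsilon)}\frac{1}{\nu_\alpha(B^+(0,\varepsilon))}\left|\int_{\mathbb{R}^d_+}f(y)\,\tau_z(\chi_{B^+(0,\varepsilon)})(-y',y_d)\,d\nu_\alpha(y)\right|.$$ The same formula is used for $f\in L^p(\mathbb{R}^d_+,\nu_\alpha)$. *)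

(* Defs.v *)
From HB Require Import structures.
From mathcomp Require Import all_boot all_order all_algebra.
From mathcomp Require Import all_classical all_reals all_analysis.
From mathcomp Require Import measurable_realfun.

Set Implicit Arguments.
Unset Strict Implicit.
Unset Printing Implicit Defensive.

Import Order.TTheory GRing.Theory Num.Theory.
Import numFieldNormedType.Exports.

Local Open Scope classical_set_scope.
Local Open Scope ring_scope.

(* A point of R^d is written (x', x_d) with x' in R^(d-1); for d >= 1 this is
   R^d, the case d = 0 (where d.-1 = 0) is never used. The sigma-algebra is the
   Borel one (product of the Borel sigma-algebras of the coordinates). *)
Notation euclidean R d :=
  (d.-1.-tuple (measurableTypeR R) * measurableTypeR R)%type (only parsing).

(* For a product of two arbitrary sigma-finite measures, the library's canonical
   sigma-finite instance is shadowed by the one for subprobabilities. *)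
Lemma sigma_finite_product d1 d2 (T1 : measurableType d1)
    (T2 : measurableType d2) (R : realType)
    (m1 : {sigma_finite_measure set T1 -> \bar R})
    (m2 : {sigma_finite_measure set T2 -> \bar R}) :
  sigma_finite setT (m1 \x m2)%E.
Proof.
have /sigma_finiteP[F [TF ndF Foo]] := sigma_finiteT m1.
have /sigma_finiteP[G [TG ndG Goo]] := sigma_finiteT m2.
exists (fun n => F n `*` G n).
  rewrite -setXTT TF TG predeqE => -[x y]; split.
    move=> [/= [n _ Fnx] [k _ Gky]]; exists (maxn n k) => //; split.
    - by move: x Fnx; exact/subsetPset/ndF/leq_maxl.
    - by move: y Gky; exact/subsetPset/ndG/leq_maxr.
  by move=> [n _ []/= ? ?]; split; exists n.
move=> k; have [? ?] := Foo k; have [? ?] := Goo k.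
split; first exact: measurableX.
by rewrite product_measure1E// lte_mul_pinfty// ge0_fin_numE.
Qed.

Section lebesgue_tuple.
Context {R : realType}.
Local Open Scope ereal_scope.

Section step.
Variables (n : nat) (m : {sigma_finite_measure set
  (n.-tuple (measurableTypeR R)) -> \bar R}).

Definition pair_cons (x : measurableTypeR R * n.-tuple (measurableTypeR R)) :
  n.+1.-tuple (measurableTypeR R) := [tuple of x.1 :: x.2].

Lemma measurable_pair_cons : measurable_fun setT pair_cons.
Proof. exact: measurable_cons. Qed.

Definition lebesgue_cons (A : set (n.+1.-tuple (measurableTypeR R))) : \bar R :=
  pushforward (lebesgue_measure \x m) pair_cons A.

Let lebesgue_cons0 : lebesgue_cons set0 = 0.
Proof. by rewrite /lebesgue_cons /pushforward preimage_set0 measure0. Qed.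

Let lebesgue_cons_ge0 A : 0 <= lebesgue_cons A.
Proof. exact: (measure_ge0 (lebesgue_measure \x m)). Qed.

Let lebesgue_cons_sigma_additive : semi_sigma_additive lebesgue_cons.
Proof.
move=> F mF tF mUF; rewrite /lebesgue_cons /pushforward preimage_bigcup.
have mp B : measurable B -> measurable (pair_cons @^-1` B).
  by move=> mB; rewrite -[X in measurable X]setTI; exact: measurable_pair_cons.
apply: measure_semi_sigma_additive.
- by move=> i; exact: mp.
- apply/trivIsetP => /= i j _ _ ij; rewrite -preimage_setI.
  by move/trivIsetP : tF => /(_ _ _ _ _ ij) ->//; rewrite preimage_set0.
- by rewrite -preimage_bigcup; exact: mp.
Qed.

HB.instance Definition _ := isMeasure.Build _ _ _ lebesgue_cons
  lebesgue_cons0 lebesgue_cons_ge0 lebesgue_cons_sigma_additive.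

Let lebesgue_cons_sigma_finite : sigma_finite setT lebesgue_cons.
Proof.
have [F TF mF] := sigma_finite_product lebesgue_measure m.
pose g (x : n.+1.-tuple (measurableTypeR R)) :
    measurableTypeR R * n.-tuple (measurableTypeR R) :=
  (tnth x ord0, [tuple of behead x]).
have mg : measurable_fun setT g.
  apply/measurable_fun_pair; first exact: measurable_tnth.
  exact: measurable_behead.
have gK x : g (pair_cons x) = x.
  by case: x => a t; congr pair; apply/val_inj.
exists (fun k => g @^-1` F k).
  by rewrite -preimage_bigcup -TF preimage_setT.
move=> k; have [mFk Fkoo] := mF k; split.
  by rewrite -[X in measurable X]setTI; exact: mg.
rewrite /lebesgue_cons /pushforward -comp_preimage.
by rewrite (_ : g \o pair_cons = id)//; apply/funext.
Qed.

HB.instance Definition _ := Measure_isSigmaFinite.Build _ _ _ lebesgue_cons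
  lebesgue_cons_sigma_finite.

End step.

(* Lebesgue measure on R^n: the n-fold product of [lebesgue_measure] (a unit
   point mass for n = 0). *)
Fixpoint lebesgue_tuple (n : nat) : {sigma_finite_measure set
    (n.-tuple (measurableTypeR R)) -> \bar R} :=
  match n with
  | 0 => \d_([tuple] : 0.-tuple (measurableTypeR R))
  | n'.+1 => lebesgue_cons (lebesgue_tuple n')
  end.

End lebesgue_tuple.

Section weinstein.
Context {R : realType}.

Definition Gamma (s : R) : R :=
  \int[lebesgue_measure]_(t in `]0, +oo[) (t `^ (s - 1) * expR (- t)).

Section fixed_dimension.
Variable d : nat.
Implicit Types x y z : euclidean R d.

Definition lebesgue_euclidean : set (euclidean R d) -> \bar R :=
  (lebesgue_tuple d.-1 \x lebesgue_measure)%E.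

HB.instance Definition _ := Measure.on lebesgue_euclidean.
HB.instance Definition _ := Measure_isSigmaFinite.Build _ _ _ lebesgue_euclidean
  (sigma_finite_product (lebesgue_tuple d.-1) lebesgue_measure).

Definition halfspace : set (euclidean R d) := [set x | 0 < x.2].

Definition sub_point x y : euclidean R d :=
  ([tuple tnth x.1 i - tnth y.1 i | i < d.-1], x.2 - y.2).

Definition origin : euclidean R d := ([tuple 0 | i < d.-1], 0).

Definition enorm x : R :=
  Num.sqrt (\sum_(i < d.-1) tnth x.1 i ^+ 2 + x.2 ^+ 2).

Definition Bplus x (eps : R) : set (euclidean R d) :=
  [set y | enorm (sub_point y x) <= eps] `&` halfspace.

Variable alpha : R.

Definition weinstein_density x : R :=
  x.2 `^ (2 * alpha + 1) /
  ((2 * pi) `^ (d.-1%:R / 2) * 2 `^ alpha * Gamma (alpha + 1)).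

Lemma measurable_halfspace : measurable halfspace.
Proof.
rewrite (_ : halfspace = setT `&` snd @^-1` `]0, +oo[%classic).
  by apply: measurable_snd => //; exact: measurable_itv.
by rewrite setTI; apply/seteqP; split => x /=; rewrite in_itv/= andbT.
Qed.

Lemma Gamma_ge0 (s : R) : 0 <= Gamma s.
Proof.
by apply: Rintegral_ge0 => t _; rewrite mulr_ge0 ?powR_ge0 ?expR_ge0.
Qed.

Lemma weinstein_density_ge0 x : 0 <= weinstein_density x.
Proof. by rewrite !mulr_ge0 ?invr_ge0 ?mulr_ge0 ?powR_ge0 ?Gamma_ge0. Qed.

Lemma measurable_weinstein_density : measurable_fun setT weinstein_density.
Proof.
apply: measurable_funM => //.
by apply: (measurableT_comp (measurable_powR _)); exact: measurable_snd.
Qed.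

(* The measure nu_alpha, extended by 0 outside the half-space. *)
Definition weinstein_measure (A : set (euclidean R d)) : \bar R :=
  (\int[lebesgue_euclidean]_(x in A `&` halfspace) (weinstein_density x)%:E)%E.

Let weinstein_measure0 : weinstein_measure set0 = 0%E.
Proof. by rewrite /weinstein_measure set0I integral_set0. Qed.

Let weinstein_measure_ge0 A : (0 <= weinstein_measure A)%E.
Proof.
by apply: integral_ge0 => x _; rewrite lee_fin weinstein_density_ge0.
Qed.

Let weinstein_measure_sigma_additive : semi_sigma_additive weinstein_measure.
Proof.
move=> F mF tF mUF; apply: cvg_toP.
  apply: ereal_nondecreasing_is_cvgn => i j ij.
  by apply: lee_sum_nneg_natr => // k _ _; exact: weinstein_measure_ge0.
rewrite /weinstein_measure setI_bigcupl ge0_integral_bigcup//=.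
- by move=> i; apply: measurableI => //; exact: measurable_halfspace.
- apply/measurable_funTS/measurableT_comp => //.
  exact: measurable_weinstein_density.
- by move=> x _; rewrite lee_fin weinstein_density_ge0.
- exact: trivIset_setIr.
Qed.

HB.instance Definition _ := isMeasure.Build _ _ _ weinstein_measure
  weinstein_measure0 weinstein_measure_ge0 weinstein_measure_sigma_additive.

Local Open Scope ereal_scope.

Definition weinstein_norm (p : \bar R) (g : euclidean R d -> \bar R) : \bar R :=
  'N[weinstein_measure]_p[g \_ halfspace].

(* Membership in L^p(R^d_+, nu_alpha) for (possibly extended-)real-valued
   functions; only the values on the half-space matter. *)
Definition in_Lp (p : \bar R) (g : euclidean R d -> \bar R) : Prop :=
  measurable_fun halfspace g /\ weinstein_norm p g < +oo.

Local Close Scope ereal_scope.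

Definition weinstein_kernel (xd yd rho : R) : R :=
  if `|xd - yd| < rho < xd + yd then
    Gamma (alpha + 1)
    * ((xd + yd) ^+ 2 - rho ^+ 2) `^ (alpha - 2^-1)
    * (rho ^+ 2 - (xd - yd) ^+ 2) `^ (alpha - 2^-1)
    / (2 `^ (2 * alpha - 1) * Num.sqrt pi * Gamma (alpha + 2^-1)
       * (xd * yd * rho) `^ (2 * alpha))
  else 0.

Local Open Scope ereal_scope.

(* [translation_ball eps x y] is
   tau_x (chi_(B^+(0, eps))) (-y', y_d), with the reflection of y' built in. *)
Definition translation_ball (eps : R) x y : \bar R :=
  \int[lebesgue_measure]_(rho in `]0%R, +oo[)
    (\1_(Bplus origin eps) ((sub_point x y).1, rho)
     * weinstein_kernel x.2 y.2 rho * rho `^ (2 * alpha + 1))%R%:E.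

Definition maximal_function (f : euclidean R d -> R) x : \bar R :=
  ereal_sup [set v | exists eps z, [/\ (0 < eps)%R, Bplus x eps z &
    v = (weinstein_measure (Bplus origin eps))^-1 *
        `|\int[weinstein_measure]_(y in halfspace)
            ((f y)%:E * translation_ball eps z y)| ]].

End fixed_dimension.
End weinstein.

(* Main.v *)
Require Import Defs.
From HB Require Import structures.
From mathcomp Require Import all_boot all_order all_algebra.
From mathcomp Require Import all_classical all_reals all_analysis.
From mathcomp Require Import measurable_realfun ess_sup_inf ring lra.

(** The averages defining the maximal function are not averages over balls: the
    translate by z of the indicator of B^+(0, e) is a function of y supported in
    the cube Q(z, e) of center z and half side e. The proof shows that it is
    dominated by a normalized indicator of that cube, so that the maximal
    function is controlled by a Hardy-Littlewood maximal operator for a doubling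
    measure.

    The domination goes as follows. Bounding the Weinstein kernel by incomplete
    Beta integrals shows that the translate is at most a constant times
    (e / (z_d + e))^(2 alpha + 1) (lemma [kernel_mass_le]). As nu(Q(z, e)) has
    the order of magnitude of e^d (z_d + e)^(2 alpha + 1), and nu(B^+(0, e)) that
    of e^(d + 2 alpha + 1), the translate is at most
    C nu(B^+(0, e)) / nu(Q(z, e)) on Q(z, e) (lemma [translation_ball_le]).
    Every average occurring in M f is therefore bounded by C times the mean of
    |f| over the cube. For p = +oo this is already the theorem.

    For p < +oo, the same size estimates make nu doubling, and a Vitali covering
    argument on finite families of cubes (lemma [vitali_cubes]) yields
    nu {M f > t} <= (K / t) \int_{|f| > c t} |f| (lemma [maximal_weak_type]). The
    truncation in the right-hand side replaces the sublinearity of M; integrating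
    against t^(p - 1) dt and exchanging integrals (lemma [marcinkiewicz_le])
    turns this inequality into the L^p bound.

    Measurability of M f is not automatic, because M f is a supremum over an
    uncountable family of closed balls, and a union of closed balls need not be a
    Borel set. The averages are, however, right continuous in the radius (lemma
    [ball_integral_right_continuous]), so that a ball on which an average exceeds
    t can be slightly enlarged; the superlevel sets of M f are then unions of
    cubes with rational data, hence countable unions (lemma
    [maximal_function_superlevel]), and the same countable unions are the ones
    to which the covering argument is applied. *)

Set Implicit Arguments.
Unset Strict Implicit.
Unset Printing Implicit Defensive.

Import Order.TTheory GRing.Theory Num.Theory.
Import numFieldNormedType.Exports.

Local Open Scope classical_set_scope.
Local Open Scope ring_scope.

(** * Integrals of powers *)

(** The integrand may blow up at both endpoints, as powers with a negative
    exponent do; the fundamental theorem of calculus is applied on closed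
    intervals exhausting the open one, and only a bound on the increments of the
    primitive survives in the limit. *)
Lemma ge0_integral_oo_le {R : realType} (f F : R -> R) (a b M : R) :
  0 <= M ->
  {in `]a, b[, forall x, 0 <= f x} ->
  {in `]a, b[, continuous f} ->
  {in `]a, b[, forall x : R, is_derive x 1 F (f x)} ->
  (forall s t, a < s -> s < t -> t < b -> F t - F s <= M) ->
  (\int[lebesgue_measure]_(x in `]a, b[) (f x)%:E <= M%:E)%E.
Proof.
move=> M0 f0 cf dF FM.
have [ab|ba] := ltP a b; last first.
  by rewrite set_itv_ge ?integral_set0 ?lee_fin// bnd_simp -leNgt.
pose e n := (b - a) / n.+3%:R.
have e0 n : 0 < e n by rewrite divr_gt0// subr_gt0.
have eh n : e n < (b - a) / 2.
  by rewrite /e ltr_pM2l ?subr_gt0// ltf_pV2 ?posrE// ltr_nat.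
have em m n : (m <= n)%N -> e n <= e m.
  by move=> mn; rewrite /e ler_pM2l ?subr_gt0// lef_pV2 ?posrE// ler_nat.
have sub n : {subset `[(a + e n), (b - e n)] <= `]a, b[}.
  move=> x; rewrite !in_itv/= => /andP[x1 x2]; have := e0 n.
  by move=> ?; apply/andP; split; lra.
have UE : `]a, b[%classic = \bigcup_n `[(a + e n), (b - e n)]%classic.
  apply/seteqP; split => [x|x [n _]]; last exact: sub.
  rewrite /= in_itv/= => /andP[ax xb].
  have [n /= nP] : exists n, (b - a) / Num.min (x - a) (b - x) < n.+3%:R.
    pose y := (b - a) / Num.min (x - a) (b - x); exists (Num.bound y).
    apply: (le_lt_trans (ler_norm _)).
    have /lt_le_trans := archi_boundP (normr_ge0 y); apply; rewrite ler_nat.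
    rewrite /Num.bound normr_id.
    by do 2 apply: leqW; exact: leqnSn.
  have mp : 0 < Num.min (x - a) (b - x) by rewrite lt_min !subr_gt0 ax xb.
  have : e n < Num.min (x - a) (b - x).
    by rewrite /e ltr_pdivrMr// mulrC -ltr_pdivrMr.
  rewrite lt_min => /andP[e1 e2].
  by exists n => //=; rewrite in_itv/=; apply/andP; split; lra.
have ge0 i x : `[(a + e i), (b - e i)]%classic x -> (0 <= (f x)%:E)%E.
  by move=> xi; rewrite lee_fin f0//; exact: sub xi.
have mf i : measurable_fun `[(a + e i), (b - e i)] (fun x => (f x)%:E).
  apply/measurable_EFinP; apply: (@measurable_funS _ _ _ _ `]a, b[) => //;
    first exact: sub.
  by apply: open_continuous_measurable_fun => // x; rewrite inE; exact: cf.
have nd : nondecreasing_seq (fun n => `[(a + e n), (b - e n)]%classic).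
  move=> m n mn; apply/subsetPset => x /=; rewrite !in_itv/= => /andP[x1 x2].
  by have := em _ _ mn => ?; apply/andP; split; lra.
have cv := ge0_nondecreasing_set_cvg_integral nd
  (fun=> measurable_itv _) mf ge0 (mu := lebesgue_measure).
rewrite UE -(cvg_lim _ cv)//; apply: lime_le; first by apply/cvg_ex; eexists;
  exact: cv.
apply: nearW => n.
have st : a + e n < b - e n by have := eh n; lra.
rewrite (@continuous_FTC2 _ f F)//.
- rewrite -EFinB lee_fin; apply: FM => //; have := e0 n; lra.
- apply: continuous_in_subspaceT => x; rewrite inE => /sub; exact: cf.
- have dF' x : x \in `[a + e n, b - e n] -> derivable F x 1.
    by move=> /sub /dF [].
  have cF x : x \in `[a + e n, b - e n] -> {for x, continuous F}.
    by move=> /dF' xx; apply: differentiable_continuous; exact/derivable1_diffP.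
  split.
  + by move=> x xi; apply: dF'; move: xi;
      rewrite !in_itv/= => /andP[/ltW-> /ltW->].
  + by apply: cvg_at_right_filter; apply: cF; rewrite in_itv/= lexx ltW.
  + by apply: cvg_at_left_filter; apply: cF; rewrite in_itv/= lexx ltW.
- move=> x xi; rewrite derive1E; apply: derive_val; apply: dF; apply: (sub n).
  by move: xi; rewrite !in_itv/= => /andP[/ltW-> /ltW->].
Qed.

Lemma le_powR {R : realType} (r x y : R) : 0 <= r -> 0 <= x -> x <= y ->
  x `^ r <= y `^ r.
Proof.
by move=> r0 x0 xy; apply: ge0_ler_powR => //; rewrite nnegrE// (le_trans x0).
Qed.

Lemma powRV {R : realType} (x r : R) : 0 <= x -> x^-1 `^ r = (x `^ r)^-1.
Proof. by move=> x0; rewrite -(powR_inv1 x0) -powRrM mulN1r powRN. Qed.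

Lemma continuous_powR {R : realType} (r x : R) : 0 < x ->
  {for x, continuous (fun t => t `^ r)}.
Proof.
move=> x0; apply: differentiable_continuous; apply/derivable1_diffP.
by have [] := is_derive1_powR r x0.
Qed.

Lemma integral_powR_le {R : realType} (s c : R) : 0 < s -> 0 <= c ->
  (\int[lebesgue_measure]_(t in `]0%R, c[) (t `^ (s - 1))%R%:E <=
    (c `^ s / s)%R%:E)%E.
Proof.
move=> s0 c0; apply: (@ge0_integral_oo_le _ _ (fun t => s^-1 * t `^ s)).
- by rewrite divr_ge0 ?powR_ge0 ?ltW.
- by move=> t _; exact: powR_ge0.
- by move=> t; rewrite in_itv/= => /andP[t0 _]; exact: continuous_powR.
- move=> t; rewrite in_itv/= => /andP[t0 _].
  have := @is_deriveZ _ _ _ _ s^-1 _ _ _ (is_derive1_powR s t0).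
  by rewrite /GRing.scale/= mulrA mulVf ?gt_eqF// mul1r.
- move=> u t u0 ut tc; rewrite [leRHS]mulrC;
    apply: (@le_trans _ _ (s^-1 * t `^ s)).
    by rewrite gerBl mulr_ge0 ?invr_ge0 ?powR_ge0 ?ltW.
  by rewrite ler_pM2l ?invr_gt0// le_powR// ltW// (lt_trans u0).
Qed.

Lemma integral_sqrB_powR_le {R : realType} (s a c : R) : 0 < s -> 0 <= a <= c ->
  (\int[lebesgue_measure]_(t in `]a, c[) ((t ^+ 2 - a ^+ 2) `^ (s - 1) * t)%R%:E
     <= ((c ^+ 2 - a ^+ 2) `^ s / (2 * s))%R%:E)%E.
Proof.
move=> s0 /andP[a0 ac].
have sq t : a < t -> 0 < t ^+ 2 - a ^+ 2.
  by move=> at_; rewrite subr_gt0 ltr_pXn2r// nnegrE// ltW// (le_lt_trans a0).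
apply: (@ge0_integral_oo_le _ _ (fun t => (2 * s)^-1 * (t ^+ 2 - a ^+ 2) `^ s)).
- by rewrite divr_ge0 ?powR_ge0 ?mulr_ge0 ?ltW.
- move=> t; rewrite in_itv/= => /andP[t0 _].
  by rewrite mulr_ge0 ?powR_ge0// ltW// (le_lt_trans a0).
- move=> t; rewrite in_itv/= => /andP[at_ _].
  apply: cvgM => //; apply: (@continuous_comp R R R (fun t =>
    t ^+ 2 - a ^+ 2) (fun u => u `^ (s - 1))).
    by apply: cvgB; [exact: exprn_continuous|exact: cvg_cst].
  exact/continuous_powR/sq.
- move=> t; rewrite in_itv/= => /andP[at_ _].
  have d1 : is_derive t 1 (fun t : R => t ^+ 2 - a ^+ 2) (2 * t).
    by apply: is_derive_eq; rewrite /GRing.scale/=; ring.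
  have d2 := is_derive1_powR s (sq _ at_).
  have := @is_derive1_comp _ (fun u : R => u `^ s) (fun t =>
    t ^+ 2 - a ^+ 2) _ _ _ d2 d1.
  move=> /(@is_deriveZ _ _ _ _ (2 * s)^-1).
  move=> h; apply: (@is_derive_eq _ _ _ _ _ _ _ _ h).
  by rewrite /GRing.scale/=; field; rewrite gt_eqF.
- move=> u t au ut tc.
  apply: (@le_trans _ _ ((2 * s)^-1 * (t ^+ 2 - a ^+ 2) `^ s)).
    by rewrite gerBl mulr_ge0 ?invr_ge0 ?powR_ge0 ?mulr_ge0 ?ltW.
  have at_ := lt_trans au ut.
  rewrite [leRHS]mulrC ler_pM2l ?invr_gt0 ?mulr_gt0// le_powR ?ltW ?sq//.
  by rewrite ltrD2r ltr_pXn2r// nnegrE (le_trans a0)// ltW// (lt_trans at_).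
Qed.

Lemma integral_sqrBC_powR_le {R : realType} (s c b : R) : 0 < s ->
  0 <= c <= b ->
  (\int[lebesgue_measure]_(t in `]c, b[) ((b ^+ 2 - t ^+ 2) `^ (s - 1) * t)%R%:E
     <= ((b ^+ 2 - c ^+ 2) `^ s / (2 * s))%R%:E)%E.
Proof.
move=> s0 /andP[c0 cb].
have sq t : 0 <= t -> t < b -> 0 < b ^+ 2 - t ^+ 2.
  by move=> t0 tb; rewrite subr_gt0 ltr_pXn2r// nnegrE ltW// (le_lt_trans t0).
apply: (@ge0_integral_oo_le _ _ (fun t =>
  - ((2 * s)^-1 * (b ^+ 2 - t ^+ 2) `^ s))).
- by rewrite divr_ge0 ?powR_ge0 ?mulr_ge0 ?ltW.
- move=> t; rewrite in_itv/= => /andP[t0 _].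
  by rewrite mulr_ge0 ?powR_ge0// ltW// (le_lt_trans c0).
- move=> t; rewrite in_itv/= => /andP[ct tb].
  apply: cvgM => //; apply: (@continuous_comp R R R (fun t =>
    b ^+ 2 - t ^+ 2) (fun u => u `^ (s - 1))).
    by apply: cvgB; [exact: cvg_cst|exact: exprn_continuous].
  by apply/continuous_powR/sq => //; rewrite (le_trans c0)// ltW.
- move=> t; rewrite in_itv/= => /andP[ct tb].
  have t0 : 0 <= t by rewrite (le_trans c0)// ltW.
  have d1 : is_derive t 1 (fun t : R => b ^+ 2 - t ^+ 2) (- (2 * t)).
    by apply: is_derive_eq; rewrite /GRing.scale/=; ring.
  have d2 := is_derive1_powR s (sq _ t0 tb).
  have := @is_derive1_comp _ (fun u : R => u `^ s) (fun t =>
    b ^+ 2 - t ^+ 2) _ _ _ d2 d1.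
  move=> /(@is_deriveZ _ _ _ _ (2 * s)^-1) /is_deriveN.
  move=> h; apply: (@is_derive_eq _ _ _ _ _ _ _ _ h).
  by rewrite /GRing.scale/=; field; rewrite gt_eqF.
- move=> u t cu ut tb; rewrite opprK addrC.
  apply: (@le_trans _ _ ((2 * s)^-1 * (b ^+ 2 - u ^+ 2) `^ s)).
    by rewrite gerBl mulr_ge0 ?invr_ge0 ?powR_ge0 ?mulr_ge0 ?ltW.
  have u0 : 0 <= u by rewrite (le_trans c0)// ltW.
  have ub := lt_trans ut tb.
  rewrite [leRHS]mulrC ler_pM2l ?invr_gt0 ?mulr_gt0// le_powR ?ltW ?sq//.
  by rewrite ltrD2l ltrN2 ltr_pXn2r// nnegrE ltW.
Qed.

(** * Incomplete Beta integrals *)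

Lemma ge_powR {R : realType} (r x y : R) : r <= 0 -> 0 < x -> x <= y ->
  y `^ r <= x `^ r.
Proof.
move=> r0 x0 xy; have y0 := lt_le_trans x0 xy.
rewrite -(opprK r) powRN [leRHS]powRN lef_pV2 ?posrE ?powR_gt0//.
by apply: le_powR; rewrite ?oppr_ge0// ltW.
Qed.

(** Only the order of magnitude of the base matters, for exponents of either
    sign: the powers with exponent alpha - 1/2 are handled this way, without
    comparing alpha with 1/2. *)
Lemma powR_le_ratio {R : realType} (r k u v : R) : 1 <= k -> 0 < u ->
  u <= k * v -> v <= k * u -> v `^ r <= k `^ `|r| * u `^ r.
Proof.
move=> k1 u0 uv vu; have k0 : 0 < k by rewrite (lt_le_trans _ k1).
have v0 : 0 < v by rewrite -(pmulr_rgt0 _ k0) (lt_le_trans u0).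
have [r0|/ltW r0] := leP 0 r.
  by rewrite ger0_norm// -powRM ?(ltW k0) ?(ltW u0)// le_powR// ltW.
rewrite ler0_norm// powRN mulrC ler_pdivlMr ?powR_gt0// -powRM ?(ltW k0)
  ?(ltW v0)//.
by rewrite ge_powR// mulrC.
Qed.

Section beta.
Context {R : realType}.
Implicit Types s a b c : R.
Local Notation mu := (@lebesgue_measure R).

Let mpow (r : R) (f : R -> R) : measurable_fun setT f ->
  measurable_fun setT (fun t => f t `^ r).
Proof. by move=> mf; apply: (measurableT_comp (measurable_powR r) mf). Qed.

(** In the variable u = t ^+ 2 this is half the integrand of Euler's Beta
    integral with both exponents s - 1, on the segment [a ^+ 2, b ^+ 2]. *)
Definition beta_integrand s a b t : R :=
  (b ^+ 2 - t ^+ 2) `^ (s - 1) * (t ^+ 2 - a ^+ 2) `^ (s - 1) * t.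

Lemma measurable_beta_integrand s a b D :
  measurable_fun D (EFin \o beta_integrand s a b).
Proof.
apply: measurable_funTS; apply/measurable_EFinP; apply: measurable_funM => //.
by apply: measurable_funM; apply: mpow; apply: measurable_funB.
Qed.

(** Below the midpoint of [a ^+ 2, b ^+ 2] the factor b ^+ 2 - t ^+ 2 stays
    within a factor 2 of b ^+ 2 - a ^+ 2, so that only the factor vanishing at a
    has to be integrated. *)
Lemma beta_integral_head_le s a b c : 0 < s -> 0 <= a < b -> a <= c ->
  2 * c ^+ 2 <= a ^+ 2 + b ^+ 2 ->
  (\int[mu]_(t in `]a, c]) (beta_integrand s a b t)%:E <=
   (2 `^ `|s - 1| * (b ^+ 2 - a ^+ 2) `^ (s - 1)
    * ((c ^+ 2 - a ^+ 2) `^ s / (2 * s)))%R%:E)%E.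
Proof.
move=> s0 /andP[a0 ab] ac cab.
have D0 : 0 < b ^+ 2 - a ^+ 2.
  by rewrite subr_gt0 ltr_pXn2r// nnegrE ltW// (le_lt_trans a0).
set k := 2 `^ _ * _.
have k0 : 0 <= k by rewrite mulr_ge0 ?powR_ge0.
pose g t := ((t ^+ 2 - a ^+ 2) `^ (s - 1) * t)%:E.
have g0 t : `]a, c]%classic t -> (0 <= g t)%E.
  by rewrite /= in_itv/= => /andP[a_t _];
    rewrite lee_fin mulr_ge0 ?powR_ge0// (le_trans a0)// ltW.
have mg : measurable_fun setT g.
  by apply/measurable_EFinP; apply: measurable_funM => //; apply: mpow;
    apply: measurable_funB.
apply: (@le_trans _ _ (\int[mu]_(t in `]a, c]) (k%:E * g t))%E).
  apply: ge0_le_integral => //.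
  - move=> t; rewrite /= in_itv/= => /andP[a_t _].
    by rewrite lee_fin !mulr_ge0 ?powR_ge0// (le_trans a0)// ltW.
  - exact: measurable_beta_integrand.
  - by apply: measurable_funTS; apply: measurable_funeM.
  - move=> t tac; move: (tac); rewrite /= in_itv/= => /andP[a_t tc].
    have t0 : 0 <= t by rewrite (le_trans a0)// ltW.
    have tc2 : t ^+ 2 <= c ^+ 2 by rewrite ler_pXn2r// nnegrE (le_trans t0).
    have at2 : a ^+ 2 <= t ^+ 2 by rewrite ler_pXn2r// ?nnegrE// ltW.
    rewrite -EFinM lee_fin /beta_integrand -mulrA ler_wpM2r//.
      by rewrite mulr_ge0 ?powR_ge0.
    by apply: powR_le_ratio => //; [rewrite ler1n|lra|lra].
rewrite ge0_integralZl//; last first.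
  by apply: measurable_funTS.
rewrite [leRHS]EFinM lee_wpmul2l ?lee_fin//.
rewrite -integral_itv_bndo_bndc; last exact: measurable_funTS.
by apply: integral_sqrB_powR_le => //; rewrite a0.
Qed.

Lemma beta_integral_tail_le s a b c : 0 < s -> 0 <= a < b -> 0 <= c <= b ->
  a ^+ 2 + b ^+ 2 <= 2 * c ^+ 2 ->
  (\int[mu]_(t in `]c, b[) (beta_integrand s a b t)%:E <=
   (2 `^ `|s - 1| * (b ^+ 2 - a ^+ 2) `^ (s - 1)
    * ((b ^+ 2 - c ^+ 2) `^ s / (2 * s)))%R%:E)%E.
Proof.
move=> s0 /andP[a0 ab] /andP[c0 cb] cab.
have D0 : 0 < b ^+ 2 - a ^+ 2.
  by rewrite subr_gt0 ltr_pXn2r// nnegrE ltW// (le_lt_trans a0).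
set k := 2 `^ _ * _.
have k0 : 0 <= k by rewrite mulr_ge0 ?powR_ge0.
pose g t := ((b ^+ 2 - t ^+ 2) `^ (s - 1) * t)%:E.
have g0 t : `]c, b[%classic t -> (0 <= g t)%E.
  by rewrite /= in_itv/= => /andP[a_t _];
    rewrite lee_fin mulr_ge0 ?powR_ge0// (le_trans c0)// ltW.
have mg : measurable_fun setT g.
  by apply/measurable_EFinP; apply: measurable_funM => //; apply: mpow;
    apply: measurable_funB.
apply: (@le_trans _ _ (\int[mu]_(t in `]c, b[) (k%:E * g t))%E).
  apply: ge0_le_integral => //.
  - move=> t; rewrite /= in_itv/= => /andP[a_t _].
    by rewrite lee_fin !mulr_ge0 ?powR_ge0// (le_trans c0)// ltW.
  - exact: measurable_beta_integrand.
  - by apply: measurable_funTS; apply: measurable_funeM.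
  - move=> t tac; move: (tac); rewrite /= in_itv/= => /andP[c_t tb].
    have t0 : 0 <= t by rewrite (le_trans c0)// ltW.
    have tc2 : c ^+ 2 <= t ^+ 2 by rewrite ler_pXn2r// ?nnegrE// ltW.
    have at2 : t ^+ 2 <= b ^+ 2 by rewrite ler_pXn2r// ?nnegrE ltW//
      (le_lt_trans a0).
    rewrite -EFinM lee_fin /beta_integrand mulrAC -[leLHS]mulrC ler_wpM2r//.
      by rewrite mulr_ge0 ?powR_ge0.
    by apply: powR_le_ratio => //; [rewrite ler1n|lra|lra].
rewrite ge0_integralZl//; last first.
  by apply: measurable_funTS.
rewrite [leRHS]EFinM lee_wpmul2l ?lee_fin//.
by apply: integral_sqrBC_powR_le => //; rewrite c0.
Qed.

Lemma beta_integral_le s a b : 0 < s -> 0 <= a < b ->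
  (\int[mu]_(t in `]a, b[) (beta_integrand s a b t)%:E <=
   (2 `^ `|s - 1| / s * (b ^+ 2 - a ^+ 2) `^ (2 * s - 1))%R%:E)%E.
Proof.
move=> s0 /[dup] ab0 /andP[a0 ab].
have b0 : 0 < b by rewrite (le_lt_trans a0).
have D0 : 0 < b ^+ 2 - a ^+ 2 by rewrite subr_gt0 ltr_pXn2r// nnegrE ltW.
(* c ^+ 2 is the midpoint of [a ^+ 2, b ^+ 2] *)
pose c := Num.sqrt ((a ^+ 2 + b ^+ 2) / 2).
have c2 : c ^+ 2 = (a ^+ 2 + b ^+ 2) / 2.
  by rewrite sqr_sqrtr// divr_ge0// addr_ge0 ?sqr_ge0.
have c0 : 0 <= c by exact: sqrtr_ge0.
have ac : a <= c by rewrite -(@ler_pXn2r _ 2)// ?nnegrE// c2; lra.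
have cb' : c < b by rewrite -(@ltr_pXn2r _ 2)// ?nnegrE ?(ltW b0)// c2; lra.
have cb := ltW cb'.
have E0 t : `]a, b[%classic t -> (0 <= (beta_integrand s a b t)%:E)%E.
  rewrite /= in_itv/= => /andP[a_t _].
  by rewrite lee_fin !mulr_ge0 ?powR_ge0// (le_trans a0)// ltW.
have abE : `]a, b[%classic = `]a, c] `|` `]c, b[ :> set R.
  by apply: itv_bndbnd_setU; rewrite bnd_simp.
rewrite abE ge0_integral_setU//=; first last.
- apply/disj_setPS => t; rewrite /= !in_itv/= => -[/andP[_ tc] /andP[ct _]].
  by move: (lt_le_trans ct tc); rewrite ltxx.
- by move=> t; move: (E0 t); rewrite abE.
- exact: measurable_beta_integrand.
have cab1 : 2 * c ^+ 2 <= a ^+ 2 + b ^+ 2 by rewrite c2; lra.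
have cab2 : a ^+ 2 + b ^+ 2 <= 2 * c ^+ 2 by rewrite c2; lra.
apply: (le_trans (leeD (beta_integral_head_le s0 ab0 ac cab1)
  (@beta_integral_tail_le s a b c s0 ab0 _ cab2))); first by rewrite c0.
rewrite -EFinD lee_fin -mulrDr -mulrDl.
have -> : b ^+ 2 - c ^+ 2 = (b ^+ 2 - a ^+ 2) / 2 by rewrite c2; lra.
have -> : c ^+ 2 - a ^+ 2 = (b ^+ 2 - a ^+ 2) / 2 by rewrite c2; lra.
set D := b ^+ 2 - a ^+ 2 in D0 *.
have le1 : (D / 2) `^ s <= D `^ s.
  by apply: le_powR; rewrite ?divr_ge0 ?(ltW s0) ?(ltW D0)//; lra.
have -> : D `^ (2 * s - 1) = D `^ (s - 1) * D `^ s.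
  rewrite -powRD; last by rewrite (gt_eqF D0) implybT.
  by congr (_ `^ _); lra.
rewrite -!mulrA ler_wpM2l ?powR_ge0// [leRHS]mulrCA ler_wpM2l ?powR_ge0//.
by rewrite [leRHS]mulrC invfM mulrA ler_pM2r ?invr_gt0//; lra.
Qed.

End beta.

(** * The Weinstein kernel *)

Local Ltac nneg := by do ?[assumption | exact: powR_ge0 | exact: sqr_ge0
  | exact: ltW | apply: mulr_ge0 | rewrite invr_ge0 | exact: sqrtr_ge0 |
    exact: Gamma_ge0].

Section kernel.
Context {R : realType}.
Variable alpha : R.
Hypothesis halpha : - 2^-1 < alpha.
Implicit Types x y e : R.
Local Notation mu := (@lebesgue_measure R).

Let K : R := Gamma (alpha + 1) /
  (2 `^ (2 * alpha - 1) * Num.sqrt pi * Gamma (alpha + 2^-1)).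

Let K_ge0 : 0 <= K.
Proof. by rewrite divr_ge0 ?mulr_ge0 ?powR_ge0 ?sqrtr_ge0 ?Gamma_ge0. Qed.

Let s := alpha + 2^-1.

Let s_gt0 : 0 < s. Proof. by rewrite /s -ltrBlDr sub0r. Qed.

Lemma weinstein_kernel_ge0 x y t : 0 <= weinstein_kernel alpha x y t.
Proof.
rewrite /weinstein_kernel; by case: ifP => // _; nneg.
Qed.

(** The density rho^(2 alpha + 1) leaves exactly one factor rho once the powers
    rho^(2 alpha) cancel, which is what makes the substitution u = rho^2 work. *)
Lemma weinstein_kernel_betaE x y t : 0 < x -> 0 < y -> 0 < t ->
  weinstein_kernel alpha x y t * t `^ (2 * alpha + 1) =
  if `|x - y| < t < x + y then
    K * (x * y) `^ (- (2 * alpha)) * beta_integrand s `|x - y| (x + y) t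
  else 0.
Proof.
move=> x0 y0 t0; rewrite /weinstein_kernel; case: ifP => _;
  last by rewrite mul0r.
have xy0 : 0 < x * y by rewrite mulr_gt0.
rewrite /beta_integrand real_normK ?num_real//.
have -> : s - 1 = alpha - 2^-1 by rewrite /s; lra.
rewrite (powRM _ (ltW xy0) (ltW t0)) powRN.
rewrite (@powRD _ t); last by rewrite (gt_eqF t0) implybT.
rewrite powRr1 ?ltW// /K.
set A := (x * y) `^ _; set B := t `^ _.
have A0 : A != 0 by rewrite gt_eqF// powR_gt0.
have B0 : B != 0 by rewrite gt_eqF// powR_gt0.
have -> : forall g u v w : R, g * u * v / (w * (A * B)) * (B * t) =
  g * u * v / w / A * t * (B / B) by move=> g u v w; rewrite !invfM; ring.
by rewrite divff// mulr1; ring.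
Qed.

Lemma integral_weinstein_kernelE x y (D : set R) : 0 < x -> 0 < y ->
  measurable D -> D `<=` `]0, +oo[%classic ->
  (\int[mu]_(t in D)
    (weinstein_kernel alpha x y t * t `^ (2 * alpha + 1))%R%:E =
  (K * (x * y) `^ (- (2 * alpha)))%R%:E *
  \int[mu]_(t in D `&` `]`|x - y|%R, (x + y)%R[)
    (beta_integrand s `|x - y| (x + y) t)%:E)%E.
Proof.
move=> x0 y0 mD D0.
have mI : measurable (D `&` `]`|x - y|, (x + y)[) by exact: measurableI.
rewrite -ge0_integralZl//; first last.
- by rewrite lee_fin mulr_ge0 ?powR_ge0.
- move=> t [/D0]; rewrite /= in_itv/= andbT => t0 _.
  by rewrite lee_fin !mulr_ge0 ?powR_ge0// ltW.
- exact: measurable_beta_integrand.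
rewrite [LHS]integral_mkcond [RHS]integral_mkcond.
apply: eq_integral => t _.
rewrite !patchE; have [tD|tD] := boolP (t \in D); last first.
  by rewrite ifF//; apply: contraNF tD; rewrite !inE => -[].
have t0 : 0 < t by move: tD; rewrite inE => /D0; rewrite /= in_itv/= andbT.
rewrite weinstein_kernel_betaE// in_setI tD/= mem_setE in_itv/=.
by case: ifP => // _; rewrite EFinM.
Qed.

(** If 2 e < x, a nonzero integrand forces y >= x / 2 and rho^2 <= x^2 + y^2,
    which is the midpoint of the squares of x - y and x + y: the estimate of the
    head of the Beta integral gives the order (e^2 / (x y))^(alpha + 1/2).
    Otherwise e / (x + e) >= 1/3, and it suffices that the total mass of the
    kernel is bounded, the powers of x y cancelling out. *)
Lemma kernel_mass_le : exists2 C, 0 < C & forall x y e, 0 < x -> 0 < y ->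
  0 < e ->
  (\int[mu]_(t in `]0%R, e])
     (weinstein_kernel alpha x y t * t `^ (2 * alpha + 1))%R%:E
   <= (C * (e / (x + e)) `^ (2 * alpha + 1))%R%:E)%E.
Proof.
have sE : 2 * alpha + 1 = 2 * s by rewrite /s; lra.
(* C1 serves for 2 * e < x, and C2 for x <= 2 * e *)
pose C1 := K * 2 `^ `|s - 1| * 4 `^ (s - 1) * (9 / 2) `^ s / (2 * s).
pose C2 := K * (2 `^ `|s - 1| / s) * 4 `^ (2 * s - 1) * 3 `^ (2 * s).
have C1_ge0 : 0 <= C1 by rewrite /C1; nneg.
have C2_ge0 : 0 <= C2 by rewrite /C2; nneg.
exists (C1 + C2 + 1); first by rewrite ltr_wpDl ?addr_ge0.
move=> x y e x0 y0 e0.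
set q := e / (x + e).
have xe0 : 0 < x + e by rewrite addr_gt0.
have q0 : 0 < q by rewrite divr_gt0.
have xy0 : 0 < x * y by rewrite mulr_gt0.
have xyN : `|x - y| < x + y by rewrite real_ltr_norml ?num_real//; lra.
have ab0 : 0 <= `|x - y| < x + y by rewrite normr_ge0.
have DE : (x + y) ^+ 2 - `|x - y| ^+ 2 = 4 * (x * y).
  by rewrite real_normK ?num_real//; ring.
have I0 : `]0, e] `<=` `]0, +oo[.
  by move=> t; rewrite /= !in_itv/= andbT => /andP[].
have beta0 t : 0 < t -> (0 <= (beta_integrand s `|x - y| (x + y) t)%:E)%E.
  by move=> t0; rewrite lee_fin !mulr_ge0 ?powR_ge0// ltW.
have beta0' (b : itv_bound R) t : [set` Interval (BRight `|x - y|) b] t ->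
    (0 <= (beta_integrand s `|x - y| (x + y) t)%:E)%E.
  rewrite /= itv_boundlr bnd_simp => /andP[xyt _]; apply: beta0.
  exact: le_lt_trans xyt.
have k0 : 0 <= K * (x * y) `^ (- (2 * alpha)) by rewrite mulr_ge0 ?powR_ge0.
have aE : - (2 * alpha) = - (2 * s - 1) by rewrite /s; lra.
rewrite (integral_weinstein_kernelE x0 y0 (measurable_itv _) I0) sE.
have [ex|ex] := ltP (2 * e) x.
  apply: (@le_trans _ _ (C1 * q `^ (2 * s))%:E); last first.
    by rewrite lee_fin ler_wpM2r ?powR_ge0//; lra.
  have [ae|ea] := leP `|x - y| e; last first.
    have -> : `]0, e]%classic `&` `]`|x - y|, (x + y)[ = set0 :> set R.
      apply/seteqP; split => // t; rewrite /= !in_itv/= =>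
        -[/andP[_ te] /andP[a_t _]].
      by have := lt_trans a_t (le_lt_trans te ea); rewrite ltxx.
    by rewrite integral_set0 mule0 lee_fin; nneg.
  have yx : x / 2 <= y by move: ae; rewrite ler_norml; lra.
  apply: (@le_trans _ _ ((K * (x * y) `^ (- (2 * alpha)))%:E *
    \int[mu]_(t in `]`|x - y|%R, e]) (beta_integrand s `|x - y|%R
      (x + y)%R t)%:E)%E).
    rewrite lee_wpmul2l ?lee_fin//; apply: ge0_subset_integral => //.
    - exact: measurableI.
    - exact: measurable_beta_integrand.
    - exact: beta0'.
    - move=> t; rewrite /= !in_itv/= => -[/andP[_ ->] /andP[-> _]]//.
  have c2 : 2 * e ^+ 2 <= `|x - y| ^+ 2 + (x + y) ^+ 2.
    rewrite real_normK ?num_real//.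
    have : e ^+ 2 <= x ^+ 2 by rewrite ler_pXn2r// ?nnegrE; lra.
    by have := sqr_ge0 y; nra.
  apply: (le_trans (lee_wpmul2l _ (beta_integral_head_le s_gt0 ab0 ae c2))).
    by rewrite lee_fin.
  rewrite -EFinM lee_fin DE aE (@powRM _ 4 (x * y)) ?(ltW xy0)//.
  apply: (@le_trans _ _ (K * 2 `^ `|s - 1| * 4 `^ (s - 1) * (x * y) `^ (- s)
     * (e ^+ 2) `^ s / (2 * s))).
    have -> : (x * y) `^ (- s) = (x * y) `^ (s - 1) * (x * y) `^ (-
      (2 * s - 1)).
      rewrite -powRD; last by rewrite (gt_eqF xy0) implybT.
      by congr (_ `^ _); ring.
    have : (e ^+ 2 - `|x - y| ^+ 2) `^ s <= (e ^+ 2) `^ s.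
      apply: le_powR; first exact: ltW.
        by rewrite subr_ge0 ler_pXn2r// nnegrE// ltW.
      by rewrite gerBl sqr_ge0.
    move=> /ler_wpM2l h.
    have := h (K * 2 `^ `|s - 1| * 4 `^ (s - 1) *
      ((x * y) `^ (s - 1) * (x * y) `^ (- (2 * s - 1))) / (2 * s)).
    move=> /(_ ltac:(nneg)).
    by congr (_ <= _); ring.
  have -> : q `^ (2 * s) = (e ^+ 2) `^ s * ((x + e) ^+ 2) `^ (- s).
    rewrite powRrM /q powR_mulrn ?(ltW q0)// expr_div_n
      powRM ?invr_ge0 ?sqr_ge0//.
    by rewrite powRN -!powRN -powR_inv1 ?sqr_ge0// -powRrM mulN1r.
  have h : (x * y) `^ (- s) <= (9 / 2) `^ s * ((x + e) ^+ 2) `^ (- s).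
    have -> : (9 / 2) `^ s = (2 / 9) `^ (- s) :> R.
      by rewrite powRN -[in RHS]invf_div -(@powR_inv1 _
        (9 / 2)) ?divr_ge0// -powRrM mulN1r powRN invrK.
    rewrite -powRM ?sqr_ge0 ?divr_ge0//; apply: ge_powR.
    - by rewrite oppr_le0 ltW.
    - by rewrite mulr_gt0 ?exprn_gt0.
    - have : (x + e) ^+ 2 <= (3 / 2 * x) ^+ 2 by rewrite ler_pXn2r// ?nnegrE;
        lra.
      have : x * (x / 2) <= x * y by rewrite ler_pM2l.
      by rewrite exprMn; nra.
  have := ler_wpM2l (_ : 0 <= K * 2 `^ `|s - 1| * 4 `^ (s - 1) *
    (e ^+ 2) `^ s / (2 * s)) h.
  move=> /(_ ltac:(nneg)).
  by congr (_ <= _); rewrite /C1; ring.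
apply: (@le_trans _ _ (C2 * q `^ (2 * s))%:E); last first.
  by rewrite lee_fin ler_wpM2r ?powR_ge0//; lra.
apply: (@le_trans _ _ ((K * (x * y) `^ (- (2 * alpha)))%:E *
  \int[mu]_(t in `]`|x - y|%R, (x + y)%R[) (beta_integrand s `|x - y|%R
    (x + y)%R t)%:E)%E).
  rewrite lee_wpmul2l ?lee_fin//; apply: ge0_subset_integral => //.
  - exact: measurableI.
  - exact: measurable_beta_integrand.
  - exact: beta0'.
apply: (le_trans (lee_wpmul2l _ (beta_integral_le s_gt0 ab0))).
  by rewrite lee_fin.
rewrite -EFinM lee_fin DE aE (@powRM _ 4 (x * y)) ?(ltW xy0)//.
have h : 1 <= 3 `^ (2 * s) * q `^ (2 * s).
  rewrite -powRM ?(ltW q0)//; apply: (@le_trans _ _ (1 `^ (2 * s)));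
    first by rewrite powR1.
  apply: le_powR; rewrite ?mulr_ge0 ?(ltW s_gt0)//.
  by rewrite /q mulrA ler_pdivlMr// mul1r; lra.
have -> : K * (x * y) `^ (- (2 * s - 1)) *
  (2 `^ `|s - 1| / s * (4 `^ (2 * s - 1) * (x * y) `^ (2 * s - 1))) =
  K * (2 `^ `|s - 1| / s) * 4 `^ (2 * s - 1).
  rewrite powRN; set A := (x * y) `^ _.
  have A0 : A != 0 by rewrite gt_eqF// powR_gt0.
  by field; rewrite A0 gt_eqF.
rewrite /C2 -[X in _ <= X]mulrA ler_peMr//.
by nneg.
Qed.

End kernel.

(** * Positivity of the Gamma function *)

Section gamma.
Context {R : realType}.
Implicit Types s t : R.
Local Notation mu := (@lebesgue_measure R).

Let f s t := t `^ (s - 1) * expR (- t).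

Let mf s D : measurable_fun D (EFin \o f s).
Proof.
apply: measurable_funTS; apply/measurable_EFinP; apply: measurable_funM.
  exact: measurable_powR.
by apply: measurableT_comp => //; exact: measurable_funN.
Qed.

Let f_ge0 s t : 0 <= f s t.
Proof. by rewrite mulr_ge0 ?powR_ge0 ?expR_ge0. Qed.

(* the integrable majorant on [1, +oo[ is a multiple of the density of an
   exponential law of rate 1/2 *)
Let tail_le s : exists2 C, 0 <= C & forall t, 1 <= t ->
  f s t <= C * exponential_pdf 2^-1 t.
Proof.
set r := s - 1; pose k := 2 * `|r| + 1.
have k0 : 0 < k by rewrite ltr_wpDl// mulr_ge0.
exists (2 * k `^ `|r|); first by rewrite mulr_ge0 ?powR_ge0.
move=> t t1; have t0 : 0 <= t by rewrite (le_trans _ t1).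
rewrite exponential_pdfE// /f -/r.
have -> : 2 * k `^ `|r| * (2^-1 * expR (- 2^-1 * t)) =
  k `^ `|r| * expR (t / 2) * expR (- t).
  rewrite -[RHS]mulrA -expRD (_ : t / 2 - t = - 2^-1 * t); last lra.
  by field.
rewrite ler_wpM2r ?expR_ge0//.
apply: (@le_trans _ _ (t `^ `|r|)); first by rewrite ler_powR// ler_norm.
rewrite -[X in X `^ _](divfK (lt0r_neq0 k0)) mulrC powRM ?divr_ge0 ?(ltW k0)//.
rewrite ler_wpM2l ?powR_ge0//.
apply: (@le_trans _ _ (expR (t / k) `^ `|r|)).
  apply: le_powR; rewrite ?divr_ge0 ?(ltW k0)//.
  by apply: le_trans (expR_ge1Dx _); rewrite lerDr.
rewrite /powR gt_eqF ?expR_gt0// expRK ler_expR.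
by rewrite mulrCA ler_wpM2l// ler_pdivrMr// /k; lra.
Qed.

(** The integral must be shown finite as well as positive, since an infinite
    integral would have the real value 0. *)
Lemma Gamma_gt0 s : 0 < s -> 0 < Gamma s.
Proof.
move=> s0; rewrite /Gamma /Rintegral fine_gt0//; apply/andP; split.
  apply: (@lt_le_trans _ _ (\int[mu]_(t in `[1%R,
    2%R]) (2 `^ (- `|s - 1|) * expR (- 2))%R%:E)%E).
    rewrite integral_cst//= lebesgue_measure_itv/= lte_fin ltr1n -EFinB -EFinM
      lte_fin.
    by rewrite !mulr_gt0 ?powR_gt0 ?expR_gt0//; lra.
  apply: (@le_trans _ _ (\int[mu]_(t in `[1%R, 2%R]) (f s t)%:E)%E).
    apply: ge0_le_integral => //.
    - exact: mf.
    - move=> t; rewrite /= in_itv/= => /andP[t1 t2].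
      rewrite lee_fin /f ler_pM ?powR_ge0 ?expR_ge0//;
        last by rewrite ler_expR lerN2.
      rewrite powRN -[leLHS]mul1r ler_pdivrMr ?powR_gt0// mulrC.
      have := @powR_le_ratio _ (s - 1) 2 t 1; rewrite powR1; apply; lra.
  apply: ge0_subset_integral => //.
  - exact: mf.
  - by move=> t _; rewrite lee_fin.
  - by move=> t; rewrite /= !in_itv/= andbT => /andP[t1 _];
      exact: lt_le_trans t1.
have [C C0 fC] := tail_le s.
have E : `]0, +oo[%classic = `]0, 1[ `|` `[1, +oo[ :> set R.
  by apply: itv_bndbnd_setU; rewrite ?bnd_simp.
rewrite E ge0_integral_setU//=; first last.
- apply/disj_setPS => t; rewrite /= !in_itv/= andbT => -[/andP[_ t1] t2].
  by move: (lt_le_trans t1 t2); rewrite ltxx.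
- by move=> t _; rewrite lee_fin; exact: f_ge0.
- exact: mf.
apply: lte_add_pinfty.
  apply: (@le_lt_trans _ _ (\int[mu]_(t in `]0%R, 1%R[) (t `^ (s - 1))%R%:E)%E).
    apply: ge0_le_integral => //.
    - by move=> t _; rewrite lee_fin; exact: f_ge0.
    - exact: mf.
    - by apply: measurable_funTS; apply/measurable_EFinP;
        exact: measurable_powR.
    - move=> t; rewrite /= in_itv/= => /andP[t0 _].
      by rewrite lee_fin ler_piMr ?powR_ge0// expR_le1 oppr_le0 ltW.
  by apply: (le_lt_trans (integral_powR_le s0 ler01)); rewrite ltry.
have me : measurable_fun setT (EFin \o exponential_pdf (2^-1 : R)).
  by apply/measurable_EFinP; exact: measurable_exponential_pdf.
have e0 t : (0 <= (exponential_pdf (2^-1 : R) t)%:E)%E.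
  by rewrite lee_fin exponential_pdf_ge0.
apply: (@le_lt_trans _ _ (C%:E * \int[mu]_t (exponential_pdf
  (2^-1 : R) t)%:E)%E); last first.
  by rewrite integral_exponential_pdf// mule1 ltry.
rewrite -ge0_integralZl//.
apply: (@le_trans _ _ (\int[mu]_(t in `[1%R,
  +oo[) (C%:E * (exponential_pdf (2^-1 : R) t)%:E))%E).
  apply: ge0_le_integral => //.
  - by move=> t _; rewrite lee_fin; exact: f_ge0.
  - exact: mf.
  - by apply: measurable_funTS; apply: measurable_funeM.
  - move=> t; rewrite /= in_itv/= andbT => t1.
    by rewrite -EFinM lee_fin; exact: fC.
apply: ge0_subset_integral => //.
- exact: measurable_funeM.
- by move=> t _; rewrite mule_ge0.
Qed.

End gamma.

(** * Cubes and their measure *)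

Section boxes.
Context {R : realType}.
Local Notation T n := (n.-tuple (measurableTypeR R)).

Definition tcube n (c : T n) (r : R) : set (T n) :=
  [set t | forall i, `|tnth t i - tnth c i| <= r].

Lemma measurable_tcube n (c : T n) r : measurable (tcube c r).
Proof.
have -> : tcube c r = \bigcap_(i in [set: 'I_n])
    ((fun t : T n => tnth t i) @^-1` `[tnth c i - r, tnth c i + r]).
  apply/seteqP; split => [t tc i _|t tc i].
    by rewrite /= in_itv/= -ler_distlC distrC.
  by have := tc i I; rewrite /= in_itv/= -ler_distlC distrC.
apply: fin_bigcap_measurable => // i _; rewrite -[X in measurable X]setTI.
by apply: measurable_tnth => //; exact: measurable_itv.
Qed.

Lemma lebesgue_tuple_tcube n (c : T n) r : 0 <= r ->
  lebesgue_tuple n (tcube c r) = ((2 * r) ^+ n)%:E.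
Proof.
move=> r0; elim: n c => [|n IH] c.
  by rewrite /= diracE mem_set// => -[].
pose c0 : R := tnth c ord0; pose c' : T n := [tuple of behead c].
have c'E i : tnth c' i = tnth c (lift ord0 i).
  by rewrite tnth_behead; congr tnth; apply: val_inj; rewrite /= inordK ?ltnS.
rewrite /= /lebesgue_cons /pushforward.
have -> : @pair_cons R n @^-1` tcube c r = `[c0 - r, c0 + r] `*` tcube c' r.
  apply/seteqP; split => [[x t] h|[x t] [/= xc xt] i].
    split => /=.
      by have := h ord0; rewrite /= in_itv/= -ler_distlC distrC tnth0.
    by move=> i; have := h (lift ord0 i); rewrite c'E tnthS.
  case: (unliftP ord0 i) => [j ->|->].
    by have := xt j; rewrite c'E tnthS.
  by rewrite tnth0; move: xc; rewrite in_itv/= -ler_distlC distrC.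
rewrite product_measure1E//; last exact: measurable_tcube.
rewrite IH [X in (X * _)%E](_ : _ =
  lebesgue_measure (`[c0 - r, c0 +
  r]%classic : set R))// lebesgue_measure_itv/= lte_fin.
case: ifPn => [h|].
  by rewrite -EFinB -EFinM exprS; congr (_ * _)%:E; lra.
rewrite -leNgt => h; have -> : r = 0 by lra.
by rewrite mul0e mulr0 expr0n.
Qed.

End boxes.

Section cubes.
Context {R : realType}.
Variable d : nat.
Implicit Types (x y z : euclidean R d) (r e : R).

(** Cubes are used in place of balls because their measure is a product and
    because they are compared coordinate by coordinate. *)
Definition cube z r : set (euclidean R d) :=
  tcube z.1 r `*` `[z.2 - r, z.2 + r].

Lemma measurable_cube z r : measurable (cube z r).
Proof. by apply: measurableX; [exact: measurable_tcube|exact: measurable_itv].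
  Qed.

Lemma cubeP z r y :
  cube z r y <-> (forall i, `|tnth y.1 i - tnth z.1 i| <=
    r) /\ `|y.2 - z.2| <= r.
Proof.
rewrite /cube /= in_itv/= -ler_distlC distrC.
by split => -[].
Qed.

Lemma lebesgue_euclidean_slab (c : d.-1.-tuple R) r u v : 0 <= r -> u <= v ->
  lebesgue_euclidean (tcube c r `*` `[u, v] : set (euclidean R d)) =
  ((2 * r) ^+ d.-1 * (v - u))%:E.
Proof.
move=> r0 uv; rewrite /lebesgue_euclidean product_measure1E//;
  last exact: measurable_tcube.
rewrite EFinM; congr (_ * _)%E; first exact: lebesgue_tuple_tcube.
rewrite [LHS](_ : _ = lebesgue_measure (`[u, v]%classic : set R))//.
rewrite lebesgue_measure_itv/= lte_fin; case: ifPn => // h.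
have -> : u = v by apply: le_anti; rewrite uv leNgt.
by rewrite subrr.
Qed.

Lemma enorm_leE x e : 0 <= e ->
  (enorm x <= e) = (\sum_(i < d.-1) tnth x.1 i ^+ 2 + x.2 ^+ 2 <= e ^+ 2).
Proof.
move=> e0; rewrite -(@ler_pXn2r _ 2)// ?nnegrE ?sqrtr_ge0// sqr_sqrtr//.
by rewrite addr_ge0 ?sqr_ge0// sumr_ge0// => i _; exact: sqr_ge0.
Qed.

Lemma norm_tnth_le_enorm x i : `|tnth x.1 i| <= enorm x.
Proof.
rewrite -sqrtr_sqr ler_wsqrtr// (bigD1 i)//= -addrA lerDl.
by rewrite addr_ge0 ?sqr_ge0// sumr_ge0// => j _; exact: sqr_ge0.
Qed.

Lemma norm_snd_le_enorm x : `|x.2| <= enorm x.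
Proof.
rewrite -sqrtr_sqr ler_wsqrtr// lerDr.
by rewrite sumr_ge0// => j _; exact: sqr_ge0.
Qed.

Lemma Bplus_sub_cube x e : Bplus x e `<=` cube x e.
Proof.
move=> y [/= yx _]; apply/cubeP; split => [i|]; apply: le_trans yx.
  by apply: le_trans (norm_tnth_le_enorm _ i); rewrite /= tnth_mktuple.
exact: (norm_snd_le_enorm (sub_point y x)).
Qed.

Lemma cube_sub_Bplus x e : (0 < d)%N -> 0 <= e ->
  cube x (e / d%:R) `&` @halfspace R d `<=` Bplus x e.
Proof.
move=> d0 e0 y [/cubeP[y1 y2] Hy]; split => //=.
have dr : 1 <= d%:R :> R by rewrite ler1n.
have d0r : 0 < d%:R :> R by rewrite ltr0n.
have ed0 : 0 <= e / d%:R by rewrite divr_ge0.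
rewrite enorm_leE//=.
apply: (@le_trans _ _ (\sum_(i < d.-1) (e / d%:R) ^+ 2 + (e / d%:R) ^+ 2)).
  apply: lerD.
    apply: ler_sum => i _; rewrite tnth_mktuple.
    by rewrite -(real_normK (num_real _)) ler_pXn2r ?nnegrE.
  by rewrite -(real_normK (num_real _)) ler_pXn2r ?nnegrE.
rewrite sumr_const card_ord -mulrSr prednK// expr_div_n -[leLHS]mulr_natr.
by rewrite -mulrA ler_piMr ?sqr_ge0// mulrC expr2 invfM mulrA divff ?gt_eqF//
  mul1r invf_le1.
Qed.

Lemma measurable_enorm_sub x : measurable_fun setT (fun y =>
  enorm (sub_point y x)).
Proof.
apply: (measurableT_comp (f := @Num.sqrt R)).
  by apply: continuous_measurable_fun; exact: sqrt_continuous.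
apply: measurable_funD.
  apply: measurable_sum => i.
  under eq_fun do rewrite tnth_mktuple.
  apply: measurable_funX; apply: measurable_funB => //.
  by apply: (measurableT_comp (measurable_tnth i)); exact: measurable_fst.
apply: measurable_funX; apply: measurable_funB => //.
Qed.

Lemma measurable_Bplus x e : measurable (Bplus x e).
Proof.
apply: measurableI; last exact: measurable_halfspace.
rewrite -[X in measurable X]setTI.
have := measurable_enorm_sub x measurableT (measurable_itv `]-oo, e]).
by congr (measurable (_ `&` _)); apply/seteqP; split => y; rewrite /= in_itv.
Qed.

End cubes.

Section weinstein_cubes.
Context {R : realType}.
Variables (d : nat) (alpha : R).
Hypothesis (d0 : (0 < d)%N) (halpha : - 2^-1 < alpha).
Implicit Types (x y z : euclidean R d) (r e : R).
Local Notation nu := (@weinstein_measure R d alpha).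
Local Notation b := (2 * alpha + 1).

Let b0 : 0 < b. Proof. by have := halpha; rewrite -subr_gt0; lra. Qed.

Let w : R := ((2 * pi) `^ (d.-1%:R / 2) * 2 `^ alpha * Gamma (alpha + 1))^-1.

Let w_gt0 : 0 < w.
Proof.
rewrite invr_gt0 !mulr_gt0 ?powR_gt0 ?mulr_gt0 ?pi_gt0// Gamma_gt0//.
by have := b0; lra.
Qed.

Lemma weinstein_measureIhalfspace (A : set (euclidean R d)) :
  nu (A `&` @halfspace R d) = nu A.
Proof. by rewrite /weinstein_measure -setIA setIid. Qed.

Let volume z r := w * (2 * r) ^+ d.-1 * r * (z.2 + r) `^ b.

Lemma weinstein_measure_cube_le z r : 0 <= r -> 0 <= z.2 ->
  (nu (cube z r) <= (2 * volume z r)%:E)%E.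
Proof.
move=> r0 z0; rewrite /weinstein_measure.
have mI : measurable (cube z r `&` @halfspace R d).
  by apply: measurableI; [exact: measurable_cube|exact: measurable_halfspace].
apply: (@le_trans _ _ (\int[@lebesgue_euclidean R d]_(x in cube z r `&`
  @halfspace R d)
   (w * (z.2 + r) `^ b)%:E)%E).
  apply: ge0_le_integral => //.
  - by move=> x _; rewrite lee_fin weinstein_density_ge0.
  - apply: measurable_funTS; apply/measurable_EFinP;
      exact: measurable_weinstein_density.
  - move=> x [/cubeP[_ xz] Hx]; rewrite lee_fin /weinstein_density mulrC -/w.
    rewrite ler_wpM2l ?(ltW w_gt0)// le_powR ?(ltW b0) ?(ltW Hx)//.
    by move: xz; rewrite ler_norml; lra.
rewrite integral_cst//.
apply: (@le_trans _ _ ((w * (z.2 + r) `^ b)%:E *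
   lebesgue_euclidean (cube z r))%E).
  rewrite lee_wpmul2l ?lee_fin ?mulr_ge0 ?powR_ge0 ?(ltW w_gt0)//.
  by apply: le_measure; rewrite ?inE//; exact: measurable_cube.
rewrite lebesgue_euclidean_slab//; last lra.
by rewrite -EFinM lee_fin /volume le_eqVlt; apply/orP; left; apply/eqP; ring.
Qed.

(** The upper part of the cube suffices: there the last coordinate is at least
    half of z.2 + r, even if z lies on the boundary of the half-space. *)
Lemma weinstein_measure_cube_ge z r : 0 < r -> 0 <= z.2 ->
  ((2^-1 * 2 `^ (- b) * volume z r)%:E <= nu (cube z r))%E.
Proof.
move=> r0 z0; rewrite /weinstein_measure.
pose S : set (euclidean R d) := tcube z.1 r `*` `[z.2 + r / 2, z.2 + r].
have mS : measurable S.
  by apply: measurableX; [exact: measurable_tcube|exact: measurable_itv].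
have mI : measurable (cube z r `&` @halfspace R d).
  by apply: measurableI; [exact: measurable_cube|exact: measurable_halfspace].
have Sz x : S x -> z.2 + r / 2 <= x.2 <= z.2 + r by move=> [_];
  rewrite /= in_itv.
have SI : S `<=` cube z r `&` @halfspace R d.
  move=> x Sx; have /andP[x1 x2] := Sz _ Sx; split.
    by case: Sx => Sx1 _; split => //; rewrite /= in_itv/=; apply/andP; split;
      lra.
  by rewrite /halfspace/=; lra.
apply: (@le_trans _ _ (\int[@lebesgue_euclidean R d]_(x in S)
   (w * (2 `^ (- b) * (z.2 + r) `^ b))%:E)%E).
  rewrite integral_cst//.
  rewrite [X in (_ <= _ * X)%E](_ : _ =
    lebesgue_euclidean S)// lebesgue_euclidean_slab ?(ltW r0)//; last lra.
  by rewrite -EFinM lee_fin /volume le_eqVlt; apply/orP; left; apply/eqP; field.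
apply: (@le_trans _ _ (\int[@lebesgue_euclidean R d]_(x in S)
   (weinstein_density alpha x)%:E)%E).
  apply: ge0_le_integral => //.
  - by move=> x _; rewrite lee_fin !mulr_ge0 ?powR_ge0 ?(ltW w_gt0).
  - apply: measurable_funTS; apply/measurable_EFinP;
      exact: measurable_weinstein_density.
  - move=> x /Sz/andP[x1 x2]; rewrite lee_fin /weinstein_density -/w.
    rewrite [leRHS]mulrC ler_wpM2l
      ?(ltW w_gt0)// powRN mulrC ler_pdivrMr ?powR_gt0//.
    rewrite -powRM//; last by lra.
    by apply: le_powR; rewrite ?(ltW b0)//; lra.
apply: ge0_subset_integral => //.
- apply: measurable_funTS; apply/measurable_EFinP;
    exact: measurable_weinstein_density.
- by move=> x _; rewrite lee_fin weinstein_density_ge0.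
Qed.

Lemma weinstein_measure_cube_gt0 z r : 0 < r -> 0 <= z.2 ->
  (0 < nu (cube z r))%E.
Proof.
move=> r0 z0; apply: lt_le_trans (weinstein_measure_cube_ge r0 z0).
by rewrite lte_fin /volume !mulr_gt0 ?exprn_gt0 ?powR_gt0 ?mulr_gt0//; lra.
Qed.

Lemma weinstein_measure_cube_lty z r : 0 <= r -> 0 <= z.2 ->
  (nu (cube z r) < +oo)%E.
Proof.
by move=> r0 z0; apply: le_lt_trans (weinstein_measure_cube_le r0 z0) _;
  rewrite ltry.
Qed.

Lemma weinstein_measure_doubling : exists2 C, 0 < C & forall z r, 0 < r ->
  0 <= z.2 ->
  (nu (cube z (3 * r)) <= C%:E * nu (cube z r))%E.
Proof.
pose C := 2 * (3 ^+ d.-1 * 3 * 3 `^ b) / (2^-1 * 2 `^ (- b)) : R.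
have C0 : 0 < C by rewrite /C divr_gt0 ?mulr_gt0 ?exprn_gt0 ?powR_gt0.
exists C => // z r r0 z0.
have r30 : 0 <= 3 * r by lra.
apply: (le_trans (weinstein_measure_cube_le r30 z0)).
have := weinstein_measure_cube_ge r0 z0.
have C0' : (0 <= C%:E)%E by rewrite lee_fin ltW.
move=> /(lee_wpmul2l C0'); apply: le_trans.
rewrite -EFinM lee_fin /volume.
have -> : C * (2^-1 * 2 `^ (- b) * (w * (2 * r) ^+ d.-1 * r * (z.2 + r) `^ b)) =
  2 * (w * (2 * (3 * r)) ^+ d.-1 * (3 * r) * (3 `^ b * (z.2 + r) `^ b)).
  rewrite !exprMn /C; field.
  by rewrite gt_eqF ?powR_gt0.
rewrite -powRM//; last lra.
rewrite ler_wpM2l// ler_wpM2l//;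
  first by rewrite !mulr_ge0 ?exprn_ge0 ?mulr_ge0 ?(ltW w_gt0) ?(ltW r0).
by apply: le_powR; rewrite ?(ltW b0)//; lra.
Qed.

Lemma weinstein_measure_Bplus_lty e : 0 <= e ->
  (nu (Bplus (@origin R d) e) < +oo)%E.
Proof.
move=> e0; apply: le_lt_trans (weinstein_measure_cube_lty e0 (lexx 0 : 0 <=
  (@origin R d).2)).
apply: le_measure; rewrite ?inE;
  [exact: measurable_Bplus|exact: measurable_cube|].
exact: Bplus_sub_cube.
Qed.

(** Up to constants, nu (cube z e) is e^d (z.2 + e)^(2 alpha + 1), and the ball
    contains the half cube of half side e / d, of measure
    e^(d + 2 alpha + 1). *)
Lemma weinstein_measure_Bplus_ge : exists2 C, 0 < C & forall z e, 0 < e ->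
  0 < z.2 ->
  (((e / (z.2 + e)) `^ b)%:E * nu (cube z e) <=
    C%:E * nu (Bplus (@origin R d) e))%E.
Proof.
have dr : 0 < d%:R :> R by rewrite ltr0n.
pose C := 4 * (d%:R ^+ d.-1 * d%:R * d%:R `^ b) * 2 `^ b : R.
have C0 : 0 < C by rewrite /C !mulr_gt0 ?exprn_gt0 ?powR_gt0.
exists C => // z e e0 z0.
have ed0 : 0 < e / d%:R by rewrite divr_gt0.
have ze0 : 0 < z.2 + e by rewrite addr_gt0.
have le1 : (nu (cube (@origin R d) (e / d%:R)) <= nu (Bplus (@origin R d) e))%E.
  rewrite -weinstein_measureIhalfspace; apply: le_measure; rewrite ?inE.
  - by apply: measurableI; [exact: measurable_cube|exact: measurable_halfspace].
  - exact: measurable_Bplus.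
  - by apply: cube_sub_Bplus => //; exact: ltW.
have C0' : (0 <= C%:E)%E by rewrite lee_fin ltW.
apply: le_trans (lee_wpmul2l C0' le1).
have := weinstein_measure_cube_ge ed0 (lexx 0 : 0 <= (@origin R d).2).
move=> /(lee_wpmul2l C0'); apply: le_trans.
have q0 : (0 <= ((e / (z.2 + e)) `^ b)%:E)%E by rewrite lee_fin powR_ge0.
apply: (le_trans (lee_wpmul2l q0 (weinstein_measure_cube_le (ltW e0)
  (ltW z0)))).
rewrite -!EFinM lee_fin /volume/= add0r.
rewrite !powRM ?invr_ge0 ?(ltW e0) ?(ltW ze0) ?(ltW dr)//.
rewrite !powRV ?(ltW ze0) ?(ltW dr)// powRN !exprMn exprVn /C.
rewrite le_eqVlt; apply/orP; left; apply/eqP; field.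
by rewrite !gt_eqF ?powR_gt0 ?exprn_gt0.
Qed.

End weinstein_cubes.

(** * The translates of the indicator of a ball *)

Section translation.
Context {R : realType}.
Variables (d : nat) (alpha : R).
Hypothesis (d0 : (0 < d)%N) (halpha : - 2^-1 < alpha).
Implicit Types (x y z : euclidean R d) (r e : R).
Local Notation nu := (@weinstein_measure R d alpha).
Local Notation b := (2 * alpha + 1).
Local Notation mu := (@lebesgue_measure R).

(** The integrand of [translation_ball], as a function of the pair (y, rho): its
    joint measurability gives that of the translate in y by Tonelli's theorem.
    The indicator already makes it vanish for rho <= 0, so that it can be
    integrated over the whole line. *)
Definition translation_integrand e z
  (yt : euclidean R d * measurableTypeR R) : R :=
  \1_(Bplus (@origin R d) e) ((sub_point z yt.1).1, yt.2) *
  weinstein_kernel alpha z.2 yt.1.2 yt.2 * yt.2 `^ b.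

Lemma translation_integrand_ge0 e z yt : 0 <= translation_integrand e z yt.
Proof. by rewrite !mulr_ge0 ?powR_ge0 ?weinstein_kernel_ge0. Qed.

Lemma measurable_weinstein_kernel d' (T : measurableType d') x (f g : T -> R) :
  measurable_fun setT f -> measurable_fun setT g ->
  measurable_fun setT (fun u => weinstein_kernel alpha x.2 (f u) (g u)).
Proof.
move=> mf mg.
have mp (r : R) (h : T -> R) : measurable_fun setT h ->
  measurable_fun setT (fun t => h t `^ r).
  by move=> mh; apply: (measurableT_comp (measurable_powR r) mh).
have mxf : measurable_fun setT (fun u => x.2 - f u) by exact: measurable_funB.
have mxf' : measurable_fun setT (fun u => x.2 + f u) by exact: measurable_funD.
apply: measurable_fun_ifT => //.
  apply: measurable_and; apply: measurable_fun_ltr => //.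
  exact: measurableT_comp.
apply: measurable_funM; last first.
  under eq_fun do rewrite invfM -powRN.
  apply: measurable_funM => //; apply: mp.
  by do 2 apply: measurable_funM => //.
apply: measurable_funM; last first.
  by apply: mp; apply: measurable_funB; exact: measurable_funX.
apply: measurable_funM => //.
by apply: mp; apply: measurable_funB; exact: measurable_funX.
Qed.

Lemma measurable_translation_integrand e z :
  measurable_fun setT (translation_integrand e z).
Proof.
apply: measurable_funM; last first.
  by apply: (measurableT_comp (measurable_powR _)); exact: measurable_snd.
apply: measurable_funM; last first.
  apply: measurable_weinstein_kernel; last exact: measurable_snd.
  by apply: (measurableT_comp (f := snd));
    [exact: measurable_snd|exact: measurable_fst].
apply: (@measurableT_comp _ _ _ _ _ _ (\1_(Bplus
  (@origin R d) e) : euclidean R d -> R) _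
  (fun yt : euclidean R d * measurableTypeR R => ((sub_point z yt.1).1, yt.2))).
  by apply: measurable_indic; exact: measurable_Bplus.
apply/measurable_fun_pair; last exact: measurable_snd.
apply/measurable_fun_tnthP => i.
rewrite [X in measurable_fun _ X](_ : _ =
  fun yt : euclidean R d * measurableTypeR R => tnth z.1 i - tnth yt.1.1 i).
  apply: measurable_funB => //.
  apply: (measurableT_comp (measurable_tnth i)).
  by apply: (measurableT_comp (f := fst)); exact: measurable_fst.
by apply/funext => yt /=; rewrite tnth_mktuple.
Qed.

Lemma translation_ballE e z y : translation_ball alpha e z y =
  (\int[mu]_t (translation_integrand e z (y, t))%:E)%E.
Proof.
rewrite /translation_ball integral_mkcond; apply: eq_integral => t _.
rewrite patchE; case: ifPn => //; rewrite notin_setE/= in_itv/= andbT => t0.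
rewrite /translation_integrand indicE memNset ?mul0r ?mul0r// => -[_].
by rewrite /halfspace /=.
Qed.

Lemma translation_ball_ge0 e z y : (0 <= translation_ball alpha e z y)%E.
Proof.
rewrite translation_ballE; apply: integral_ge0 => t _.
by rewrite lee_fin translation_integrand_ge0.
Qed.

Lemma measurable_translation_ball e z :
  measurable_fun setT (translation_ball alpha e z).
Proof.
rewrite [X in measurable_fun _ X](_ : _ =
  fubini_F mu (EFin \o translation_integrand e z)).
  apply: measurable_fun_fubini_tonelli_F => [|yt].
    by apply/measurable_EFinP; exact: measurable_translation_integrand.
  by rewrite lee_fin translation_integrand_ge0.
by apply/funext => y; rewrite translation_ballE.
Qed.

Lemma translation_integrand_neq0 e z y t :
  translation_integrand e z (y, t) != 0 -> cube z e y /\ 0 < t <= e.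
Proof.
rewrite /translation_integrand/= indicE; case: (boolP (_ \in _));
  last by rewrite !mul0r eqxx.
rewrite inE mul1r => -[/= h t0].
rewrite /weinstein_kernel; case: ifPn => [/andP[t1 t2] _|];
  last by rewrite mul0r eqxx.
set v := sub_point _ _ in h.
have te : t <= e.
  apply: le_trans h; apply: le_trans (norm_snd_le_enorm v).
  by rewrite /= subr0 ler_norm.
split; last by apply/andP.
apply/cubeP; split => [i|].
  apply: le_trans h; apply: le_trans (norm_tnth_le_enorm v i).
  by rewrite /= !tnth_mktuple /= subr0 distrC.
by rewrite distrC (le_trans _ te)// ltW.
Qed.

Lemma translation_ball_eq0 e z y : ~ cube z e y ->
  translation_ball alpha e z y = 0%E.
Proof.
move=> h; rewrite translation_ballE; apply: integral0_eq => t _.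
by congr EFin; apply/eqP; apply/negP => /negP /translation_integrand_neq0[].
Qed.

Lemma translation_ball_le_powR : exists2 C, 0 < C & forall e z y,
  0 < e -> 0 < z.2 -> 0 < y.2 ->
  (translation_ball alpha e z y <= (C * (e / (z.2 + e)) `^ b)%:E)%E.
Proof.
have [C C0 CP] := kernel_mass_le halpha.
exists C => // e z y e0 z0 y0.
apply: le_trans (CP _ _ _ z0 y0 e0).
rewrite translation_ballE [leRHS]integral_mkcond; apply: ge0_le_integral => //.
- by move=> t _; rewrite lee_fin translation_integrand_ge0.
- apply/measurable_EFinP.
  by apply: (measurableT_comp (measurable_translation_integrand e z)).
- have mW : measurable_fun `]0, e] (fun t =>
    (weinstein_kernel alpha z.2 y.2 t * t `^ b)%:E).
    apply: measurable_funTS; apply/measurable_EFinP.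
    apply: measurable_funM; last exact: measurable_powR.
    by apply: (@measurable_weinstein_kernel _ _ z (cst y.2) id).
  by move/(measurable_restrictT _ (measurable_itv `]0, e])): mW.
- move=> t _; rewrite patchE mem_setE in_itv/=; case: ifPn => [_|].
    rewrite lee_fin /translation_integrand/= -mulrA ler_piMl//.
    by rewrite mulr_ge0 ?powR_ge0 ?weinstein_kernel_ge0.
  move=> h; change ((translation_integrand e z (y, t))%:E <= 0%:E)%E;
    rewrite lee_fin.
  have [->//|/translation_integrand_neq0[_ te]] := eqVneq
    (translation_integrand e z (y, t)) 0.
  by rewrite te in h.
Qed.

Lemma translation_ball_lty e z y : 0 < e -> 0 < z.2 -> 0 < y.2 ->
  (translation_ball alpha e z y < +oo)%E.
Proof.
move=> e0 z0 y0; have [C _ CP] := translation_ball_le_powR.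
by apply: le_lt_trans (CP _ _ _ e0 z0 y0) _; rewrite ltry.
Qed.

(** The translate is dominated by the normalized indicator of the cube; written
    without quotients to avoid infinite values. *)
Lemma translation_ball_le : exists2 C, 0 < C & forall e z y,
  0 < e -> 0 < z.2 -> 0 < y.2 ->
  (translation_ball alpha e z y * nu (cube z e) <=
   C%:E * nu (Bplus (@origin R d) e))%E.
Proof.
have [C C0 CP] := translation_ball_le_powR.
have [C' C'0 C'P] := weinstein_measure_Bplus_ge d0 halpha.
exists (C * C') => [|e z y e0 z0 y0]; first exact: mulr_gt0.
apply: (le_trans (lee_wpmul2r _ (CP _ _ _ e0 z0 y0))) => //.
rewrite !EFinM -!muleA; apply: lee_wpmul2l; first by rewrite lee_fin ltW.
exact: C'P.
Qed.

End translation.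

(** * From a truncated weak type inequality to a strong one *)

Section marcinkiewicz.
Context d (T : measurableType d) (R : realType).
Variable nu : {sigma_finite_measure set T -> \bar R}.
Variables (G : T -> \bar R) (g : T -> R) (K c p : R).
Hypotheses (p1 : 1 < p) (K0 : 0 < K) (c0 : 0 < c).
Hypotheses (mG : measurable_fun setT G) (mg : measurable_fun setT g).
Hypotheses (G0 : forall x, (0 <= G x)%E) (g0 : forall x, 0 <= g x).
Hypothesis weak : forall t, 0 < t ->
  (nu [set x | t%:E < G x] <=
   (K / t)%:E * \int[nu]_(x in [set x | (c * t < g x)%R]) (g x)%:E)%E.
Local Notation mu := (@lebesgue_measure R).
Local Open Scope ereal_scope.

Let mpow (r : R) D : measurable_fun D (fun t : R => t `^ r)%R.
Proof. by apply: measurable_funTS; exact: measurable_powR. Qed.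

Let mset (u : \bar R) : measurable [set t : R | (0 < t)%R /\ t%:E < u].
Proof.
apply: measurableI.
  have := measurable_itv `]0%R, +oo[ (R := R).
  by congr measurable; apply/seteqP; split => y; rewrite /= in_itv/= andbT.
by rewrite -[X in measurable X]setTI; apply: measurable_lte => //;
  exact/measurable_EFinP.
Qed.

(* The upper half of ]0, s[ already contributes (s / 2)^p; this also settles
   s = +oo, by letting real numbers below s grow. *)
Let powR_le_integral (s : \bar R) : 0 <= s ->
  s `^ p <= (2 `^ p)%:E *
    \int[mu]_(t in [set t | (0 < t)%R /\ t%:E < s]) (t `^ (p - 1))%:E.
Proof.
have real_le (r : R) : (0 < r)%R -> r%:E <= s ->
    (r `^ p)%:E <= (2 `^ p)%:E *
      \int[mu]_(t in [set t | (0 < t)%R /\ t%:E < s]) (t `^ (p - 1))%:E.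
  move=> r0 rs.
  have r20 : (0 < r / 2)%R by rewrite divr_gt0.
  have -> : (r `^ p)%:E = (2 `^ p)%:E *
      \int[mu]_(t in `[(r / 2)%R, r[) ((r / 2) `^ (p - 1))%:E.
    rewrite integral_cst//= lebesgue_measure_itv/= lte_fin ifT; last lra.
    rewrite -EFinB -!EFinM (_ : r - r / 2 = r / 2)%R; last lra.
    rewrite [X in (_ * X)%R]mulrC mulr_powRB1 ?(ltW r20) ?(lt_trans ltr01)//.
    by rewrite -powRM ?(ltW r20)// mulrCA divff// mulr1.
  rewrite lee_wpmul2l ?lee_fin ?powR_ge0//.
  apply: (@le_trans _ _ (\int[mu]_(t in `[(r / 2)%R, r[) (t `^ (p - 1))%:E)).
    apply: ge0_le_integral => //.
    - by move=> t _; rewrite lee_fin powR_ge0.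
    - by apply/measurable_EFinP; exact: mpow.
    - move=> t; rewrite /= in_itv/= => /andP[rt _]; rewrite lee_fin.
      by apply: le_powR => //; [rewrite subr_ge0 ltW|exact: ltW].
  apply: ge0_subset_integral => //.
  - exact: mset.
  - by apply/measurable_EFinP; exact: mpow.
  - by move=> t _; rewrite lee_fin powR_ge0.
  - move=> t; rewrite /= in_itv/= => /andP[rt tr]; split;
      first exact: lt_le_trans rt.
    by apply: lt_le_trans rs; rewrite lte_fin.
case: s real_le => [r||//] real_le s0.
- move: s0; rewrite lee_fin le_eqVlt => /predU1P[<-|r0].
    rewrite poweR_EFin powR0 ?gt_eqF
      ?(lt_trans ltr01)// mule_ge0 ?lee_fin ?powR_ge0//.
    by apply: integral_ge0 => t _; rewrite lee_fin powR_ge0.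
  by rewrite poweR_EFin; exact: real_le.
- rewrite poweRyr ?gt_eqF ?(lt_trans ltr01)// leye_eq; apply/eqP/eq_infty => t.
  have A1 : (1 <= Num.max 1 t)%R by rewrite le_max lexx.
  have A0 := lt_le_trans ltr01 A1.
  apply: le_trans (real_le _ A0 (leey _)); rewrite lee_fin.
  apply: (@le_trans _ _ (Num.max 1 t)%R); first by rewrite le_max lexx orbT.
  by apply: le1r_powR => //; exact: ltW.
Qed.

Let level_integral_le (s : R) : (0 <= s)%R ->
  \int[mu]_(t in [set t | (0 < t)%R /\ (c * t < s)%R]) (t `^ (p - 2) * s)%:E
  <= (c `^ (1 - p) / (p - 1) * s `^ p)%:E.
Proof.
move=> s0.
have -> : [set t | (0 < t)%R /\ (c * t < s)%R] = `]0%R, (s / c)%R[%classic.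
  apply/seteqP; split => t /=; rewrite in_itv/= ltr_pdivlMr// mulrC.
    by move=> [-> ->].
  by move=> /andP[-> ->].
under eq_integral do rewrite mulrC EFinM.
rewrite ge0_integralZl//; last 2 first.
- by apply/measurable_EFinP; exact: mpow.
- by move=> t _; rewrite lee_fin powR_ge0.
have p10 : (0 < p - 1)%R by rewrite subr_gt0.
have sc0 : (0 <= s / c)%R by rewrite divr_ge0// ltW.
have := integral_powR_le p10 sc0.
rewrite (_ : p - 1 - 1 = p - 2)%R; last by lra.
have s0' : 0 <= s%:E by rewrite lee_fin.
move=> /(lee_wpmul2l s0') /le_trans; apply.
rewrite -EFinM lee_fin powRM ?invr_ge0 ?(ltW c0)// powRV ?(ltW c0)//.
rewrite -[in leRHS](mulr_powRB1 s0) ?(lt_trans ltr01)//.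
rewrite -(opprB p 1) powRN le_eqVlt; apply/orP; left; apply/eqP; ring.
Qed.

Let phi (z : T * measurableTypeR R) : \bar R :=
  (\1_[set z : T * measurableTypeR R | (0 < z.2)%R /\ ((z.2 : R)%:E <
  G z.1)%E] z * z.2 `^ (p - 1))%R%:E.

Let psi (z : T * measurableTypeR R) : \bar R :=
  (\1_[set z : T * measurableTypeR R | (0 < z.2)%R /\ (c * z.2 <
    g z.1)%R] z * (z.2 `^ (p - 2) * g z.1))%R%:E.

Let mpos : measurable [set z : T * measurableTypeR R | (0 < z.2)%R].
Proof.
rewrite (_ : mkset _ = setT `&` snd @^-1` `]0%R, +oo[%classic).
  by apply: measurable_snd => //; exact: measurable_itv.
by rewrite setTI; apply/seteqP; split => x /=; rewrite in_itv/= andbT.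
Qed.

Let mphi : measurable_fun setT phi.
Proof.
apply/measurable_EFinP; apply: measurable_funM; last first.
  by apply: (measurableT_comp (measurable_powR _)); exact: measurable_snd.
apply: measurable_indic; apply: measurableI; first exact: mpos.
rewrite -[X in measurable X]setTI; apply: measurable_lte => //.
  by apply/measurable_EFinP; exact: measurable_snd.
by apply: (measurableT_comp mG); exact: measurable_fst.
Qed.

Let mpsi : measurable_fun setT psi.
Proof.
apply/measurable_EFinP; apply: measurable_funM; last first.
  apply: measurable_funM.
    by apply: (measurableT_comp (measurable_powR _)); exact: measurable_snd.
  by apply: (measurableT_comp mg); exact: measurable_fst.
apply: measurable_indic; apply: measurableI; first exact: mpos.
rewrite [X in measurable X](_ : _ =
  [set z : T * measurableTypeR R | (c * z.2)%:E < (g z.1)%:E]); last first.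
  by apply/seteqP; split => z; rewrite /= lte_fin.
rewrite -[X in measurable X]setTI; apply: measurable_lte => //.
  by apply/measurable_EFinP; apply: measurable_funM => //;
    exact: measurable_snd.
by apply/measurable_EFinP; apply: (measurableT_comp mg); exact: measurable_fst.
Qed.

(** Both sides are integrals over pairs (x, t): the p-th power of G x is at most
    2^p times the integral of t^(p-1) over t < G x, the hypothesis bounds the
    integral in x for each t, and integrating t^(p-2) g x over c t < g x for each
    x gives back (g x)^p, because p > 1. *)
Lemma marcinkiewicz_le :
  \int[nu]_x (G x `^ p) <=
  (2 `^ p * K * (c `^ (1 - p) / (p - 1)))%:E * \int[nu]_x ((g x)%:E `^ p).
Proof.
have phi0 z : 0 <= phi z by rewrite lee_fin mulr_ge0 ?powR_ge0.
have psi0 z : 0 <= psi z by rewrite lee_fin !mulr_ge0 ?powR_ge0.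
have C0 : (0 <= c `^ (1 - p) /
  (p - 1))%R by rewrite divr_ge0 ?powR_ge0// subr_ge0 ltW.
have F1 x : G x `^ p <= (2 `^ p)%:E * fubini_F mu phi x.
  apply: (le_trans (powR_le_integral (G0 x))).
  rewrite lee_wpmul2l ?lee_fin ?powR_ge0// integral_mkcond le_eqVlt;
    apply/orP; left; apply/eqP.
  apply: eq_integral => t _; rewrite patchE /phi indicE/=.
  case: ifPn; first by rewrite !inE => h; rewrite mem_set//= mul1r.
  by rewrite notin_setE => h; rewrite memNset// mul0r.
have F2 t : fubini_G nu phi t <= K%:E * fubini_G nu psi t.
  have [t0|t0] := leP t 0%R.
    have h u v (A : set (T * measurableTypeR R)) : (A `<=` [set z | (0 <
      z.2)%R]) -> (\1_A (u, t) * v = 0 :> R)%R.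
      by move=> AS; rewrite indicE memNset ?mul0r// => /AS /=; rewrite ltNge t0.
    rewrite /fubini_G (eq_integral (cst 0)); last first.
      by move=> x _; rewrite /phi h// => z [].
    rewrite integral0 mule_ge0 ?lee_fin ?(ltW K0)//; exact: integral_ge0.
  have E1 : fubini_G nu phi t = (t `^ (p - 1))%:E * nu [set x | t%:E < G x].
    have mGt : measurable [set x | t%:E < G x].
      by rewrite -[X in measurable X]setTI; apply: measurable_lte.
    rewrite -(setIT [set x | t%:E < G x]) -integral_indic// -ge0_integralZl//;
      last first.
    - by rewrite lee_fin powR_ge0.
    - by apply/measurable_EFinP; exact: measurable_indic.
    apply: eq_integral => x _; rewrite /phi -EFinM mulrC !indicE;
      congr (_ * _%:R)%:E.
    by congr nat_of_bool; apply/idP/idP; rewrite !inE/=; [case|split].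
  have E2 : fubini_G nu psi t = (t `^ (p - 2))%:E * \int[nu]_(x in [set x |
    (c * t < g x)%R]) (g x)%:E.
    have mgt : measurable [set x | (c * t < g x)%R].
      rewrite [X in measurable X](_ : _ = [set x | (c * t)%:E < (g x)%:E]);
        last first.
        by apply/seteqP; split => z; rewrite /= lte_fin.
      by rewrite -[X in measurable X]setTI; apply: measurable_lte => //;
        exact/measurable_EFinP.
    rewrite -ge0_integralZl//; last first.
    - by rewrite lee_fin powR_ge0.
    - by move=> x _; rewrite lee_fin.
    - by apply/measurable_EFinP/measurable_funTS.
    rewrite [RHS]integral_mkcond; apply: eq_integral => x _;
      rewrite patchE /psi indicE/=.
    case: ifPn; first by rewrite !inE => h; rewrite mem_set//= mul1r.
    by rewrite notin_setE => h; rewrite memNset ?mul0r// => -[].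
  rewrite E1 E2.
  have tp : 0 <= (t `^ (p - 1))%:E by rewrite lee_fin powR_ge0.
  apply: (le_trans (lee_wpmul2l tp (weak t0))).
  rewrite !muleA -!EFinM lee_wpmul2r//.
    by apply: integral_ge0 => x _; rewrite lee_fin.
  rewrite lee_fin (_ : p - 1 = p - 2 + 1)%R; last lra.
  rewrite powRD; last by rewrite (gt_eqF t0) implybT.
  rewrite powRr1 ?(ltW t0)// le_eqVlt; apply/orP; left; apply/eqP; field.
  by rewrite gt_eqF.
have F3 x : fubini_F mu psi x <= (c `^ (1 - p) / (p - 1))%:E * (g x)%:E `^ p.
  rewrite poweR_EFin -EFinM; apply: le_trans (level_integral_le (g0 x)).
  rewrite [leRHS]integral_mkcond le_eqVlt; apply/orP; left; apply/eqP.
  apply: eq_integral => t _; rewrite patchE /psi indicE/=.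
  case: ifPn; first by rewrite !inE => h; rewrite mem_set//= mul1r.
  by rewrite notin_setE => h; rewrite memNset// mul0r.
have mGp : measurable_fun setT (fun x => G x `^ p).
  exact: (measurableT_comp (measurable_poweR _)).
have mgp : measurable_fun setT (fun x => (g x)%:E `^ p).
  apply/measurable_EFinP.
  by apply: (measurableT_comp (measurable_powR _) mg).
have mFphi : measurable_fun setT (fubini_F mu phi).
  by apply: measurable_fun_fubini_tonelli_F.
have mGphi : measurable_fun setT (fubini_G nu phi).
  by apply: measurable_fun_fubini_tonelli_G.
have mFpsi : measurable_fun setT (fubini_F mu psi).
  by apply: measurable_fun_fubini_tonelli_F.
have mGpsi : measurable_fun setT (fubini_G nu psi).
  by apply: measurable_fun_fubini_tonelli_G.
apply: (@le_trans _ _ (\int[nu]_x ((2 `^ p)%:E * fubini_F mu phi x))).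
  apply: ge0_le_integral => //.
  - by move=> x _; exact: poweR_ge0.
  - by apply: measurable_funeM.
rewrite ge0_integralZl//; last by move=> x _; exact: integral_ge0.
rewrite -mulrA EFinM -muleA lee_wpmul2l ?lee_fin ?powR_ge0//.
rewrite (@fubini_tonelli _ _ _ _ _ nu mu phi)//.
apply: (@le_trans _ _ (\int[mu]_t (K%:E * fubini_G nu psi t))).
  apply: ge0_le_integral => //.
  - by move=> x _; exact: integral_ge0.
  - by apply: measurable_funeM.
  - by move=> t _; exact: F2.
rewrite ge0_integralZl//; last 2 first.
- by move=> x _; exact: integral_ge0.
- by rewrite lee_fin ltW.
rewrite EFinM -muleA lee_wpmul2l ?lee_fin ?(ltW K0)//.
rewrite -(@fubini_tonelli _ _ _ _ _ nu mu psi)// -ge0_integralZl//; last first.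
  by move=> x _; exact: poweR_ge0.
apply: ge0_le_integral => //.
- by move=> x _; exact: integral_ge0.
- by apply: measurable_funeM.
- by move=> x _; exact: F3.
Qed.

End marcinkiewicz.

(** * Vitali covering by cubes *)

Section vitali.
Context {R : realType}.
Variables (d : nat) (alpha : R).
Implicit Types (x y z : euclidean R d) (r : R) (q : euclidean R d * R).
Local Notation nu := (@weinstein_measure R d alpha).
Local Open Scope ereal_scope.

Definition cubes (s : seq (euclidean R d * R)) : set (euclidean R d) :=
  \bigcup_(q in [set` s]) cube q.1 q.2.

Lemma measurable_cubes s : measurable (cubes s).
Proof.
rewrite /cubes bigcup_seq; apply: bigsetU_measurable => q _.
exact: measurable_cube.
Qed.

Lemma cube_center z r : (0 <= r)%R -> cube z r z.
Proof. by move=> r0; apply/cubeP; split => [i|]; rewrite subrr normr0. Qed.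

Lemma cube_meet_sub z r z' r' : (r' <= r)%R ->
  cube z r `&` cube z' r' !=set0 -> cube z' r' `<=` cube z (3 * r).
Proof.
move=> rr [y [/cubeP[y1 y2] /cubeP[y1' y2']]] x /cubeP[x1 x2].
have tri (u v w c : R) : (`|u - v| <= r -> `|u - w| <= r' -> `|c - w| <= r' ->
  `|c - v| <= 3 * r)%R.
  move=> h1 h2 h3.
  have -> : (c - v)%R = ((c - w) - (u - w) + (u - v))%R by ring.
  apply: (le_trans (ler_normD _ _)); have := ler_normB (c - w)%R (u - w)%R; lra.
by apply/cubeP; split => [i|];
  [exact: tri (y1 i) (y1' i) (x1 i)|exact: tri y2 y2' x2].
Qed.

Lemma exists_max_radius (s : seq (euclidean R d * R)) : s != [::] ->
  exists2 p, p \in s & forall q, q \in s -> (q.2 <= p.2)%R.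
Proof.
elim: s => // q s IH _; have [->|/IH[p ps pm]] := eqVneq s [::].
  by exists q => [|r]; rewrite inE// => /eqP ->.
have [qp|/ltW pq] := leP q.2 p.2.
  by exists p => [|r]; rewrite inE ?ps ?orbT// => /predU1P[->//|/pm].
exists q => [|r]; rewrite inE ?eqxx// => /predU1P[->//|/pm rp].
exact: le_trans pq.
Qed.

(** A cube of largest radius, dilated three times, contains all the cubes that
    meet it. The remaining cubes are disjoint from it, so that in the induction
    on the size of the family its measure is charged to a part of the integral
    of g that the remaining cubes do not use. *)
Lemma vitali_cubes (g : euclidean R d -> \bar R) (D K : R) s :
  measurable_fun setT g -> (forall x, 0 <= g x) -> (0 <= D)%R -> (0 <= K)%R ->
  (forall q, q \in s -> nu (cube q.1 (3 * q.2)) <= D%:E * nu (cube q.1 q.2)) ->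
  (forall q, q \in s -> (0 <= q.2)%R /\
     nu (cube q.1 q.2) <= K%:E * \int[nu]_(y in cube q.1 q.2) g y) ->
  nu (cubes s) <= (D * K)%:E * \int[nu]_(y in cubes s) g y.
Proof.
move=> mg g0 D0 K0.
have [n] := ubnP (size s); elim: n s => // n IH s; rewrite ltnS => sn hD hK.
have [->|s0] := eqVneq s [::].
  rewrite /cubes set_nil bigcup_set0 measure0 mule_ge0 ?lee_fin ?mulr_ge0//.
  by apply: integral_ge0.
(* s' collects the cubes that do not meet the largest one *)
have [p ps pmax] := exists_max_radius s0.
pose s' := [seq q <- s | `[< cube p.1 p.2 `&` cube q.1 q.2 = set0 >] ].
have [p20 pK] := hK _ ps.
have ps' : (size s' < size s)%N.
  rewrite size_filter ltn_neqAle count_size andbT -all_count.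
  apply/negP => /allP /(_ _ ps)/asboolP; rewrite setIid.
  move/seteqP => [/(_ p.1) + _]; apply; exact: cube_center.
have s's q : q \in s' -> q \in s by rewrite mem_filter => /andP[].
have IH' := IH s' (leq_trans ps' sn) (fun q h => hD q (s's q h)) (fun q h =>
  hK q (s's q h)).
have sub : cubes s `<=` cube p.1 (3 * p.2) `|` cubes s'.
  move=> x [q qs xq].
  have [pq0|pq0] := pselect (cube p.1 p.2 `&` cube q.1 q.2 = set0).
    by right; exists q => //; rewrite /= mem_filter; apply/andP; split => //;
      exact/asboolP.
  left; apply: cube_meet_sub xq; first exact: pmax.
  by apply/set0P/eqP.
have m3 := measurable_cube p.1 (3 * p.2).
have mp := measurable_cube p.1 p.2.
have ms := measurable_cubes s.
have ms' := measurable_cubes s'.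
have le1 : nu (cubes s) <= nu (cube p.1 (3 * p.2)) + nu (cubes s').
  apply: (@le_trans _ _ (nu (cube p.1 (3 * p.2) `|` cubes s'))).
    by apply: le_measure; rewrite ?inE//; exact: measurableU.
  exact: measureU2.
apply: (le_trans le1).
have mgD A : measurable_fun A g by exact: measurable_funTS.
apply: (@le_trans _ _ ((D * K)%:E *
  (\int[nu]_(y in cube p.1 p.2) g y + \int[nu]_(y in cubes s') g y))).
  rewrite ge0_muleDr; [|exact: integral_ge0|exact: integral_ge0].
  apply: leeD => //; apply: (le_trans (hD _ ps)).
  by rewrite EFinM -muleA lee_wpmul2l// lee_fin.
rewrite lee_wpmul2l ?lee_fin ?mulr_ge0//.
rewrite -ge0_integral_setU//; last first.
  apply/disj_setPS => x [xp [q]];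
    rewrite /= mem_filter => /andP[/asboolP pq0 _] xq.
  by have : (cube p.1 p.2 `&` cube q.1 q.2) x by []; rewrite pq0.
apply: ge0_subset_integral => //; first exact: measurableU.
move=> x [xp|[q /s's qs xq]]; first by exists p.
by exists q.
Qed.

End vitali.

(** * Averages of a function against a translate *)

Section average.
Context {R : realType}.
Variables (d : nat) (alpha : R).
Hypothesis (d0 : (0 < d)%N) (halpha : - 2^-1 < alpha).
Variable f : euclidean R d -> R.
Hypothesis mf : measurable_fun (@halfspace R d) f.
Implicit Types (x y z : euclidean R d) (r e : R).
Local Notation nu := (@weinstein_measure R d alpha).
Local Notation H := (@halfspace R d).
Local Notation B e := (Bplus (@origin R d) e).
Local Open Scope ereal_scope.

(** Extending |f| by 0 makes it measurable on the whole space, f itself being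
    measurable on the half-space only. *)
Definition abs_halfspace y : \bar R := `|((f \_ H) y)%:E|.

Lemma abs_halfspaceE y : H y -> abs_halfspace y = `|(f y)%:E|.
Proof. by move=> Hy; rewrite /abs_halfspace patchE mem_set. Qed.

Lemma measurable_abs_halfspace : measurable_fun setT abs_halfspace.
Proof.
apply: measurableT_comp => //; apply/measurable_EFinP.
by move/(measurable_restrictT _ (@measurable_halfspace R d)): mf.
Qed.

Lemma abs_halfspace_ge0 y : 0 <= abs_halfspace y. Proof. exact: abse_ge0. Qed.

Definition ball_integral e z :=
  \int[nu]_(y in H) ((f y)%:E * translation_ball alpha e z y).

Lemma measurable_ball_integrand e z :
  measurable_fun H (fun y => (f y)%:E * translation_ball alpha e z y).
Proof.
apply: emeasurable_funM; first exact/measurable_EFinP.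
by apply: measurable_funTS; exact: measurable_translation_ball.
Qed.

Lemma ball_integrand_absE e z y : H y ->
  `|(f y)%:E * translation_ball alpha e z y| =
    abs_halfspace y * translation_ball alpha e z y.
Proof. by move=> Hy; rewrite abseM abs_halfspaceE// (gee0_abs
  (translation_ball_ge0 _ _ _ _)). Qed.

Lemma measurable_abs_ball_integrand e z :
  measurable_fun H (fun y => abs_halfspace y * translation_ball alpha e z y).
Proof.
apply: emeasurable_funM; first by apply: measurable_funTS;
  exact: measurable_abs_halfspace.
by apply: measurable_funTS; exact: measurable_translation_ball.
Qed.

Lemma abs_ball_integrand_ge0 e z y : 0 <=
  abs_halfspace y * translation_ball alpha e z y.
Proof. by apply: mule_ge0; [exact: abs_halfspace_ge0|exact:
  translation_ball_ge0]. Qed.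

Lemma abs_ball_integral_le e z :
  `|ball_integral e z| <= \int[nu]_(y in H)
    (abs_halfspace y * translation_ball alpha e z y).
Proof.
have mH := @measurable_halfspace R d.
apply: le_trans (le_abse_integral nu mH (measurable_ball_integrand e z)) _.
rewrite le_eqVlt; apply/orP; left; apply/eqP.
by apply: eq_integral => y /set_mem; exact: ball_integrand_absE.
Qed.

Lemma average_le (C : R) e z : (0 < e)%R -> (0 < z.2)%R -> (0 < C)%R ->
  (forall y, (0 < y.2)%R -> translation_ball alpha e z y * nu (cube z e) <=
    C%:E * nu (B e)) ->
  nu (cube z e) * \int[nu]_(y in H)
    (abs_halfspace y * translation_ball alpha e z y) <=
  C%:E * nu (B e) * \int[nu]_(y in cube z e) abs_halfspace y.
Proof.
move=> e0 z0 C0 CP.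
have mH := @measurable_halfspace R d.
have mQ := measurable_cube z e.
have Qfin : nu (cube z e) \is a fin_num.
  by rewrite ge0_fin_numE ?measure_ge0// weinstein_measure_cube_lty// ltW.
have Bfin : nu (B e) \is a fin_num.
  by rewrite ge0_fin_numE ?measure_ge0// weinstein_measure_Bplus_lty// ltW.
rewrite -(fineK Qfin) -(fineK Bfin) -EFinM -ge0_integralZl//; last first.
- by rewrite lee_fin fine_ge0.
- by move=> y _; exact: abs_ball_integrand_ge0.
- exact: measurable_abs_ball_integrand.
rewrite [X in _ <= _ * X]integral_mkcond.
have mg : measurable_fun setT (abs_halfspace \_ (cube z e)).
  apply/(measurable_restrictT _ mQ); apply: measurable_funTS;
    exact: measurable_abs_halfspace.
have g0 y : 0 <= (abs_halfspace \_ (cube z e)) y.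
  by rewrite patchE; case: ifPn => // _; exact: abs_halfspace_ge0.
rewrite -ge0_integralZl//; last first.
  by rewrite lee_fin mulr_ge0 ?fine_ge0 ?(ltW C0).
apply: (@le_trans _ _ (\int[nu]_(y in H) ((C * fine (nu (B e)))%:E *
  (abs_halfspace \_ (cube z e)) y))).
  apply: ge0_le_integral => //.
  - by move=> y _; rewrite mule_ge0 ?lee_fin ?fine_ge0// abs_ball_integrand_ge0.
  - by apply: measurable_funeM; exact: measurable_abs_ball_integrand.
  - by apply: measurable_funTS; apply: measurable_funeM.
  - move=> y Hy; rewrite patchE; case: ifPn => [_|]; last first.
      by rewrite notin_setE => Qy; rewrite translation_ball_eq0// !mule0.
    rewrite muleCA [leRHS]muleC lee_wpmul2l ?abs_halfspace_ge0// fineK// EFinM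
      fineK// muleC.
    exact: CP.
apply: ge0_subset_integral => //; first exact: measurable_funeM.
by move=> y _; rewrite mule_ge0// lee_fin mulr_ge0 ?fine_ge0 ?(ltW C0).
Qed.

Hypothesis floc : forall z r, (0 <= r)%R -> (0 <= z.2)%R ->
  \int[nu]_(y in cube z r) abs_halfspace y < +oo.

(** Averages of |f| over cubes being finite, so are those against translates:
    this provides the majorant for dominated convergence. *)
Lemma integrable_ball_integrand e z : (0 < e)%R -> (0 < z.2)%R ->
  nu.-integrable H (fun y => abs_halfspace y * translation_ball alpha e z y).
Proof.
move=> e0 z0; apply/integrableP; split;
  first exact: measurable_abs_ball_integrand.
under eq_integral do rewrite gee0_abs ?abs_ball_integrand_ge0//.
have [C C0 CP] := translation_ball_le d0 halpha.
have := average_le e0 z0 C0 (fun y => CP e z y e0 z0).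
have Q0 := weinstein_measure_cube_gt0 halpha e0 (ltW z0).
rewrite ltNge leye_eq => h; apply/negP => /eqP E; move: h;
  rewrite E gt0_muley//.
rewrite leye_eq => /eqP; apply/eqP; rewrite lt_eqF// lte_mul_pinfty//.
- by rewrite mule_ge0 ?measure_ge0// lee_fin ltW.
- rewrite fin_numM// ge0_fin_numE ?measure_ge0// weinstein_measure_Bplus_lty//
    ltW//.
- by apply: floc; exact: ltW.
Qed.

End average.

(** * Right continuity of the averages in the radius *)

Section right_continuity.
Context {R : realType}.
Variables (d : nat) (alpha : R).
Hypothesis (d0 : (0 < d)%N) (halpha : - 2^-1 < alpha).
Variable f : euclidean R d -> R.
Hypothesis mf : measurable_fun (@halfspace R d) f.
Implicit Types (x y z : euclidean R d) (r e : R).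
Local Notation nu := (@weinstein_measure R d alpha).
Local Notation mu := (@lebesgue_measure R).
Local Notation H := (@halfspace R d).
Local Notation B e := (Bplus (@origin R d) e).
Local Open Scope ereal_scope.
Hypothesis floc : forall z r, (0 <= r)%R -> (0 <= z.2)%R ->
  \int[nu]_(y in cube z r) abs_halfspace f y < +oo.

Local Notation rad e n := (e + n.+1%:R^-1)%R.

Let rad_gt e n : (e < rad e n)%R. Proof. by rewrite ltrDl. Qed.

Let rad_le1 e n : (rad e n <= e + 1)%R.
Proof. by rewrite lerD2l invf_le1// ler1n. Qed.

Let rad_le e m n : (m <= n)%N -> (rad e n <= rad e m)%R.
Proof. by move=> mn; rewrite lerD2l lef_pV2 ?posrE// ler_nat. Qed.

Let near_rad e r : (e < r)%R -> \forall n \near \oo, (rad e n < r)%R.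
Proof.
rewrite -subr_gt0 => er; near=> n.
rewrite -ltrBrDl; near: n; exact: (near_infty_natSinv_lt (PosNum er)).
Unshelve. all: by end_near. Qed.

Let Bplus_le e e' : (e <= e')%R -> B e `<=` B e'.
Proof. by move=> ee x [/= xe Hx]; split => //; exact: le_trans ee. Qed.

Let bigcap_Bplus e : \bigcap_n B (rad e n) = B e.
Proof.
apply/seteqP; split => x.
  move=> h; split; last by have [] := h 0%N I.
  rewrite /= leNgt; apply/negP => /near_rad[n _ /(_ n (leqnn n))].
  by rewrite ltNge; have [/= ->] := h n I.
by move=> xe n _; apply: Bplus_le xe; exact: ltW.
Qed.

Let Bplus_fin e : (0 <= e)%R -> nu (B e) \is a fin_num.
Proof. by move=> e0; rewrite ge0_fin_numE ?measure_ge0//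
  weinstein_measure_Bplus_lty. Qed.

Let cvg_Bplus e : (0 < e)%R -> nu (B (rad e n)) @[n --> \oo] --> nu (B e).
Proof.
move=> e0; rewrite -(bigcap_Bplus e).
apply: (@nonincreasing_cvg_mu _ _ _ nu (fun n => B (rad e n))).
- by apply: weinstein_measure_Bplus_lty => //;
    exact: ltW (lt_trans e0 (rad_gt _ _)).
- by move=> n; exact: measurable_Bplus.
- by rewrite bigcap_Bplus; exact: measurable_Bplus.
- by move=> m n mn; apply/subsetPset/Bplus_le/rad_le.
Qed.

Let translation_integrand_mono e e' z yt : (e <= e')%R ->
  (translation_integrand alpha e z yt <= translation_integrand alpha e' z yt)%R.
Proof.
move=> ee; rewrite /translation_integrand -!mulrA ler_wpM2r//.
  by rewrite mulr_ge0 ?powR_ge0 ?weinstein_kernel_ge0.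
rewrite !indicE; case: (boolP (_ \in B e)) => [|_]; last by case: (_ \in _).
by rewrite inE => /(Bplus_le ee) h; rewrite mem_set.
Qed.

Let measurable_ti e z y : measurable_fun setT (fun t =>
  (translation_integrand alpha e z (y, t))%:E).
Proof.
apply/measurable_EFinP.
by apply: (measurableT_comp (measurable_translation_integrand alpha e z)).
Qed.

Let cvg_translation_integrand e z yt :
  translation_integrand alpha (rad e n) z yt @[n --> \oo] -->
    translation_integrand alpha e z yt.
Proof.
rewrite /translation_integrand; set p := (_, _).
apply: cvgMl; apply: cvgMl.
suff h : \forall n \near \oo, \1_(B (rad e n)) p = \1_(B e) p :> R.
  by apply: cvg_near_cst.
have [pe|pe] := pselect (B e p).
  apply: nearW => n; rewrite !indicE !mem_set//.
  by apply: Bplus_le pe; exact: ltW.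
have [Hp|Hp] := pselect (H p); last first.
  by apply: nearW => n; rewrite !indicE !memNset// => -[].
have : (e < enorm (sub_point p (@origin R d)))%R.
  by rewrite ltNge; apply/negP => h; apply: pe.
move=> /near_rad; apply: filterS => n h.
by rewrite !indicE !memNset// => -[/=]; rewrite leNgt h.
Qed.

Let cvg_translation_ball e z y : (0 < e)%R -> (0 < z.2)%R -> (0 < y.2)%R ->
  translation_ball alpha (rad e n) z y @[n --> \oo] --> translation_ball alpha
    e z y.
Proof.
move=> e0 z0 y0.
have e10 : (0 < e + 1)%R by rewrite addr_gt0.
under eq_fun do rewrite translation_ballE.
rewrite translation_ballE.
have [] := @dominated_convergence _ _ _ mu setT measurableT
  (fun n t => (translation_integrand alpha (rad e n) z (y, t))%:E)
  (fun t => (translation_integrand alpha e z (y, t))%:E)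
  (fun t => (translation_integrand alpha (e + 1) z (y, t))%:E) => //.
- by apply: aeW => t _; apply: cvg_EFin;
    [exact: nearW|exact: cvg_translation_integrand].
- apply/integrableP; split; first exact: measurable_ti.
  under eq_integral do rewrite gee0_abs ?lee_fin ?translation_integrand_ge0//.
  by rewrite -translation_ballE translation_ball_lty.
- apply: aeW => t n _; rewrite gee0_abs ?lee_fin ?translation_integrand_ge0//.
  exact: translation_integrand_mono.
Qed.

Let translation_ball_mono e e' z y : (e <= e')%R ->
  translation_ball alpha e z y <= translation_ball alpha e' z y.
Proof.
move=> ee; rewrite !translation_ballE; apply: ge0_le_integral => //.
- by move=> t _; rewrite lee_fin translation_integrand_ge0.
- by move=> t _; rewrite lee_fin translation_integrand_mono.
Qed.

Let cvg_ball_integral e z : (0 < e)%R -> (0 < z.2)%R ->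
  ball_integral alpha f (rad e n) z @[n --> \oo] --> ball_integral alpha f e z.
Proof.
move=> e0 z0.
have e10 : (0 < e + 1)%R by rewrite addr_gt0.
have [] := @dominated_convergence _ _ _ nu H (@measurable_halfspace R d)
  (fun n y => (f y)%:E * translation_ball alpha (rad e n) z y)
  (fun y => (f y)%:E * translation_ball alpha e z y)
  (fun y => abs_halfspace f y * translation_ball alpha (e + 1) z y) => //.
- by move=> n; exact: measurable_ball_integrand.
- exact: measurable_ball_integrand.
- apply: aeW => y Hy; apply: cvgeZl => //; exact: cvg_translation_ball.
- exact: (integrable_ball_integrand d0 halpha mf floc e10 z0).
- apply: aeW => y n Hy; rewrite ball_integrand_absE//
    lee_wpmul2l ?abs_halfspace_ge0//.
  exact: translation_ball_mono.
Qed.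

(** The balls B^+(0, e') decrease to the closed ball B^+(0, e) as e' decreases
    to e. Dominated convergence, first in rho and then in y, carries this over to
    the translates and to the integrals of f against them. *)
Lemma ball_integral_right_continuous t e z : (0 < e)%R -> (0 < z.2)%R ->
  t%:E * nu (B e) < `|ball_integral alpha f e z| ->
  exists2 e', (e < e')%R & t%:E * nu (B e') < `|ball_integral alpha f e' z|.
Proof.
move=> e0 z0 te.
have Ifin e' : (0 < e')%R -> ball_integral alpha f e' z \is a fin_num.
  move=> e'0; rewrite fin_num_abs.
  apply: le_lt_trans (abs_ball_integral_le _ mf _ _) _.
  have /integrableP[_] := integrable_ball_integrand d0 halpha mf floc e'0 z0.
  by under eq_integral do rewrite gee0_abs ?abs_ball_integrand_ge0//.
have rad0 n : (0 < rad e n)%R := lt_trans e0 (rad_gt e n).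
pose F e' := (`|fine (ball_integral alpha f e' z)| - t * fine (nu (B e')))%R.
have FE e' : (0 < e')%R -> (t%:E * nu (B e') <
  `|ball_integral alpha f e' z|) = (0 < F e')%R.
  move=> e'0; rewrite -(fineK (Ifin _ e'0)) -(fineK (Bplus_fin (ltW e'0))).
  by rewrite -EFinM lte_fin /F/= subr_gt0.
have cF : F (rad e n) @[n --> \oo] --> F e.
  apply: cvgB.
    apply: cvg_norm; apply: fine_cvg; rewrite fineK ?Ifin//.
    exact: cvg_ball_integral.
  apply: cvgMr; apply: fine_cvg; rewrite fineK ?Bplus_fin ?(ltW e0)//.
  exact: cvg_Bplus.
move: te; rewrite FE// => /(cvgr_gt _ cF)[n _ /(_ n (leqnn n))] h.
by exists (rad e n) => //; rewrite FE.
Qed.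

End right_continuity.

(** * Small cubes with rational coordinates *)

Section covering.
Context {R : realType}.
Variable d : nat.
Implicit Types (x y z : euclidean R d) (r e : R).

Definition rational_cube (k : d.-1.-tuple rat * rat * rat) : set
  (euclidean R d) :=
  cube ([tuple ratr (tnth k.1.1 i) | i < d.-1], ratr k.1.2) (ratr k.2).

Lemma rational_cube_basis x r : 0 < r ->
  exists k, rational_cube k x /\ rational_cube k `<=` cube x r.
Proof.
move=> r0; have r20 : 0 < r / 2 by rewrite divr_gt0.
have [q] := rat_in_itvoo r20; rewrite in_itv/= => /andP[q0 qr].
have near u : exists v : rat, `|u - ratr v| <= ratr q :> R.
  have /rat_in_itvoo[v] : u - ratr q < u + ratr q by lra.
  by rewrite in_itv/= => h; exists v; rewrite ler_norml; apply/andP; split; lra.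
have [c cP] := fin_all_exists (fun i => near (tnth x.1 i)).
have [b bP] := near x.2.
exists ([tuple c i | i < d.-1], b, q); split.
  by apply/cubeP; split => [i|//] /=; rewrite !tnth_mktuple.
move=> y /cubeP[/= y1 y2].
have tri (u v w : R) : `|u - w| <= ratr q -> `|v - w| <= ratr q ->
  `|v - u| <= r.
  by rewrite !ler_norml => /andP[? ?] /andP[? ?]; apply/andP; split; lra.
apply/cubeP; split => [i|]; last exact: tri bP y2.
by have := y1 i; rewrite !tnth_mktuple => h; exact: tri (cP i) h.
Qed.

Lemma measurable_rational_cube k : measurable (rational_cube k).
Proof. exact: measurable_cube. Qed.

(** A quantitative continuity of the norm, coordinate by coordinate, which
    avoids the triangle inequality. *)
Lemma enorm_sub_near z x e e' : 0 <= e -> e < e' ->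
  enorm (sub_point z x) <= e ->
  exists2 r, 0 < r & cube x r `<=` [set y | enorm (sub_point z y) <= e'].
Proof.
move=> e0 ee ze; have e'0 : 0 <= e' by rewrite ltW// (le_lt_trans e0).
pose D := e' ^+ 2 - e ^+ 2.
have D0 : 0 < D by rewrite subr_gt0 ltr_pXn2r// nnegrE.
pose n : R := d.-1.+1%:R.
have n0 : 0 < n by rewrite ltr0n.
(* chosen so that the d coordinates together add at most D to the square *)
pose r := Num.min 1 (D / (n * (2 * e + 1))).
have c0 : 0 < n * (2 * e + 1) by rewrite mulr_gt0//; lra.
have r0 : 0 < r by rewrite lt_min ltr01 divr_gt0.
have r1 : r <= 1 by rewrite ge_min lexx.
have rD : n * (2 * e + 1) * r <= D.
  by rewrite mulrC -ler_pdivlMr// ge_min lexx orbT.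
exists r => // y /cubeP[y1 y2]; rewrite /= enorm_leE//=.
have step (u v w : R) : `|u - v| <= e -> `|w - v| <= r ->
    (u - w) ^+ 2 <= (u - v) ^+ 2 + (2 * e + 1) * r.
  rewrite !ler_norml => /andP[h1 h2] /andP[h3 h4].
  have -> : (u - w) ^+ 2 = (u - v) ^+ 2 - 2 * (u - v) * (w - v) +
    (w - v) ^+ 2 by ring.
  nra.
have xe1 i := le_trans (norm_tnth_le_enorm (sub_point z x) i) ze.
have xe2 := le_trans (norm_snd_le_enorm (sub_point z x)) ze.
move: ze; rewrite enorm_leE//= => ze.
apply: (@le_trans _ _ (\sum_(i <
  d.-1) (tnth (sub_point z x).1 i ^+ 2 + (2 * e + 1) * r)
   + ((z.2 - x.2) ^+ 2 + (2 * e + 1) * r))).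
  apply: lerD; last exact: step.
  apply: ler_sum => i _; rewrite /= !tnth_mktuple; apply: step => //.
  by have := xe1 i; rewrite /= tnth_mktuple.
rewrite big_split/= sumr_const card_ord addrACA -mulrSr -mulr_natl.
move: rD; rewrite /D /n -mulrA; move: ze; lra.
Qed.

End covering.

(** * Superlevel sets of the maximal function *)

Section maximal.
Context {R : realType}.
Variables (d : nat) (alpha : R).
Hypothesis (d0 : (0 < d)%N) (halpha : - 2^-1 < alpha).
Variable f : euclidean R d -> R.
Hypothesis mf : measurable_fun (@halfspace R d) f.
Implicit Types (x y z : euclidean R d) (r e t : R).
Local Notation nu := (@weinstein_measure R d alpha).
Local Notation H := (@halfspace R d).
Local Notation B e := (Bplus (@origin R d) e).
Local Notation Mf := (maximal_function alpha f).
Local Open Scope ereal_scope.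
Hypothesis floc : forall z r, (0 <= r)%R -> (0 <= z.2)%R ->
  \int[nu]_(y in cube z r) abs_halfspace f y < +oo.

Lemma weinstein_measure_Bplus_gt0 e : (0 < e)%R -> 0 < nu (B e).
Proof.
move=> e0; have [C C0 CP] := weinstein_measure_Bplus_ge d0 halpha.
pose z : euclidean R d := ([tuple 0%R | i < d.-1], 1%R).
have z0 : (0 < z.2)%R by [].
have := CP z e e0 z0; rewrite lt0e measure_ge0 andbT; apply: contraTneq => ->.
rewrite mule0 -ltNge mule_gt0//; last exact: weinstein_measure_cube_gt0.
by rewrite lte_fin powR_gt0// divr_gt0// addr_gt0.
Qed.

(** The pairs (e, z) whose average, in the supremum defining the maximal
    function, is larger than t. *)
Definition exceeding t e z := [/\ (0 < e)%R, (0 < z.2)%R &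
  t%:E * nu (B e) < `|ball_integral alpha f e z|].

Lemma maximal_function_gtP t x : t%:E < Mf x <->
  exists e z, exceeding t e z /\ (enorm (sub_point z x) <= e)%R.
Proof.
have E e z : (0 < e)%R -> (t%:E <
  (nu (B e))^-1 * `|ball_integral alpha f e z|) =
    (t%:E * nu (B e) < `|ball_integral alpha f e z|).
  move=> e0; have B0 := weinstein_measure_Bplus_gt0 e0.
  have Bfin : nu (B e) \is a fin_num.
    by rewrite ge0_fin_numE ?measure_ge0// weinstein_measure_Bplus_lty// ltW.
  have b0 : (0 < fine (nu (B e)))%R by rewrite fine_gt0// B0/= ltey_eq Bfin.
  by rewrite -(fineK Bfin) inver gt_eqF// muleC lte_pdivlMr.
split.
  move=> /ereal_sup_gt[_ [e [z [e0 [/= xz z0] ->]]]] h.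
  by exists e, z; split => //; split => //; rewrite -E.
move=> [e [z [[e0 z0 h] xz]]]; apply/ereal_sup_gtP.
exists ((nu (B e))^-1 * `|ball_integral alpha f e z|); last by rewrite E.
by exists e, z; split => //; split.
Qed.

Lemma maximal_function_ge0 x : H x -> 0 <= Mf x.
Proof.
move=> Hx; apply: (@le_trans _ _ ((nu
  (B 1))^-1 * `|ball_integral alpha f 1 x|)).
  by rewrite mule_ge0// inve_ge0 measure_ge0.
apply: ereal_sup_ubound; exists 1%R, x; split => //; split => //=.
have -> : sub_point x x = @origin R d.
  by congr pair; [apply: eq_from_tnth => i;
    rewrite !tnth_mktuple subrr|rewrite subrr].
rewrite enorm_leE// /origin/= big1 => [|i _];
  last by rewrite tnth_mktuple expr0n.
by rewrite expr0n addr0 expr1n ler01.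
Qed.

(** A pair (e, z) whose average exceeds t can be replaced by (e', z) with
    e' > e, so that every point of the closed ball of radius e becomes interior
    to the new ball and lies in a rational cube contained in it. The inclusion
    in [cube z e] prepares the covering argument. *)
Lemma maximal_function_superlevel t : exists F : (set (euclidean R d))^nat,
  H `&` [set x | t%:E < Mf x] = \bigcup_n F n /\
  forall n, measurable (F n) /\
    (F n = set0 \/ exists e z, exceeding t e z /\ F n `<=` cube z e).
Proof.
pose P k := exists e z, exceeding t e z /\
  rational_cube k `<=` [set x | (enorm (sub_point z x) <= e)%R].
pose F n := if unpickle n is Some k then
  (if `[< P k >] then rational_cube k `&` H else set0) else set0.
exists F; split => [|n]; last first.
  rewrite /F; case: (unpickle n) => [k|]; last by split; [|left].
  case: ifPn => [/asboolP[e [z [ez kz]]]|_]; last by split; [|left].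
  split.
    by apply: measurableI; [exact: measurable_rational_cube|exact:
      measurable_halfspace].
  right; exists e, z; split => // x [/kz xz Hx].
  apply/cubeP; split => [i|].
    apply: le_trans xz; apply: le_trans (norm_tnth_le_enorm _ i).
    by rewrite tnth_mktuple distrC.
  by rewrite distrC; apply: le_trans xz;
    exact: (norm_snd_le_enorm (sub_point z x)).
apply/seteqP; split => x.
  move=> [Hx /maximal_function_gtP[e [z [[e0 z0 h] xz]]]].
  have [e' ee' h'] := ball_integral_right_continuous d0 halpha mf floc e0 z0 h.
  have [r r0 xr] := enorm_sub_near (ltW e0) ee' xz.
  have [k [kx kr]] := rational_cube_basis x r0.
  exists (pickle k) => //; rewrite /F pickleK ifT//.
  apply/asboolP; exists e', z; split; first by split => //; exact: lt_trans ee'.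
  by move=> y /kr/xr.
move=> [n _]; rewrite /F; case: (unpickle n) => [k|//].
case: ifPn => // /asboolP[e [z [ez kz]]] [/kz xz Hx]; split => //.
by apply/maximal_function_gtP; exists e, z.
Qed.

Lemma measurable_maximal_function : measurable_fun H Mf.
Proof.
have mH := @measurable_halfspace R d.
apply: (measurability _ (ErealGenOInfty.measurableE R)) => //.
move=> /= _ [_ [a ->]] <-; rewrite preimage_itvoy.
have [F [-> FP]] := maximal_function_superlevel a.
by apply: bigcupT_measurable => n; have [] := FP n.
Qed.

End maximal.

(** * The weak type inequality *)

Section weak_type.
Context {R : realType}.
Variables (d : nat) (alpha : R).
Hypothesis (d0 : (0 < d)%N) (halpha : - 2^-1 < alpha).
Implicit Types (x y z : euclidean R d) (r e t : R).
Local Notation nu := (@weinstein_measure R d alpha).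
Local Notation H := (@halfspace R d).
Local Notation B e := (Bplus (@origin R d) e).
Local Open Scope ereal_scope.

Lemma exceeding_cube_le (f : euclidean R d -> R) (C : R) t e z :
  measurable_fun H f -> (0 < C)%R ->
  (forall e z y, (0 < e)%R -> (0 < z.2)%R -> (0 < y.2)%R ->
     translation_ball alpha e z y * nu (cube z e) <= C%:E * nu (B e)) ->
  exceeding alpha f t e z ->
  t%:E * nu (cube z e) <= C%:E * \int[nu]_(y in cube z e) abs_halfspace f y.
Proof.
move=> mf C0 CP [e0 z0 te].
have Bpos := weinstein_measure_Bplus_gt0 d0 halpha e0.
have Bfin : nu (B e) \is a fin_num.
  by rewrite ge0_fin_numE ?measure_ge0// weinstein_measure_Bplus_lty// ltW.
have b0 : (0 < fine (nu (B e)))%R by rewrite fine_gt0// Bpos/= ltey_eq Bfin.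
have := average_le halpha mf e0 z0 C0 (fun y => CP e z y e0 z0).
have := lt_le_trans te (abs_ball_integral_le alpha mf e z) => /ltW.
move=> /(lee_wpmul2l (measure_ge0 nu (cube z e))) h1 /(le_trans h1).
rewrite -(fineK Bfin) [leLHS]muleC [leLHS]muleAC [leRHS]muleAC.
by rewrite lee_pmul2r.
Qed.

(** The values of |f| below t / (2 C) account for at most half of the left-hand
    side of [exceeding_cube_le], and can be absorbed since cubes have finite
    measure. *)
Lemma exceeding_truncated_cube_le (f : euclidean R d -> R) (C : R) t e z :
  measurable_fun H f -> (0 < C)%R -> (0 < t)%R ->
  (forall e z y, (0 < e)%R -> (0 < z.2)%R -> (0 < y.2)%R ->
     translation_ball alpha e z y * nu (cube z e) <= C%:E * nu (B e)) ->
  \int[nu]_(y in cube z e) abs_halfspace f y < +oo ->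
  exceeding alpha f t e z ->
  nu (cube z e) <= (2 * C / t)%:E *
   \int[nu]_(y in cube z e) (abs_halfspace f \_ [set y | (t / (2 * C))%:E <
     abs_halfspace f y]) y.
Proof.
move=> mf C0 t0 CP foo ex.
have := exceeding_cube_le mf C0 CP ex; have [e0 z0 _] := ex.
set L := [set y | _].
have mabs := measurable_abs_halfspace mf.
have mL : measurable L by rewrite -[X in measurable X]setTI;
  apply: measurable_lte.
have mh : measurable_fun setT (abs_halfspace f \_ L).
  by apply/(measurable_restrictT _ mL); exact: measurable_funTS.
have h0 y : 0 <= (abs_halfspace f \_ L) y by rewrite patchE;
  case: ifPn => // _; exact: abs_halfspace_ge0.
have mQ := measurable_cube z e.
have Qfin : nu (cube z e) \is a fin_num.
  by rewrite ge0_fin_numE ?measure_ge0// weinstein_measure_cube_lty// ltW.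
have le1 : \int[nu]_(y in cube z e) abs_halfspace f y <=
    \int[nu]_(y in cube z e) (abs_halfspace f \_ L) y + (t / (2 * C))%:E * nu
      (cube z e).
  rewrite -integral_cst// -ge0_integralD//; last 2 first.
  - exact: measurable_funTS.
  - by move=> y _; rewrite lee_fin divr_ge0 ?mulr_ge0 ?ltW.
  apply: ge0_le_integral => //.
  - by move=> y _; exact: abs_halfspace_ge0.
  - exact: measurable_funTS.
  - by apply: emeasurable_funD => //; exact: measurable_funTS.
  - move=> y _; rewrite patchE; case: ifPn => [_|].
      by rewrite leeDl// lee_fin divr_ge0 ?mulr_ge0 ?ltW.
    by rewrite notin_setE/= add0e => /negP; rewrite -leNgt.
have hfin : \int[nu]_(y in cube z e) (abs_halfspace f \_ L) y \is a fin_num.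
  rewrite ge0_fin_numE ?integral_ge0//; apply: le_lt_trans foo.
  apply: ge0_le_integral => //.
  - exact: measurable_funTS.
  - exact: measurable_funTS.
  - by move=> y _; rewrite patchE; case: ifPn => // _; exact: abs_halfspace_ge0.
have C0' : 0 <= C%:E by rewrite lee_fin ltW.
move=> /le_trans /(_ (lee_wpmul2l C0' le1)).
move: Qfin hfin; generalize (nu (cube z e)) => -[q||]// _.
generalize (\int[nu]_(y in cube z e) (abs_halfspace f \_ L) y) => -[X||]// _.
rewrite -EFinM -EFinD -!EFinM !lee_fin.
have -> : (C * (X + t / (2 * C) * q) = C * X + t * q / 2)%R by field;
  rewrite gt_eqF.
move=> h; rewrite mulrAC ler_pdivlMr// mulrC; lra.
Qed.

(** The superlevel set is an increasing limit of finite unions of sets, each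
    contained in a cube to which [exceeding_truncated_cube_le] applies; the
    bound given by [vitali_cubes] does not depend on the number of cubes. *)
Lemma maximal_weak_type : exists K c : R, [/\ (0 < K)%R, (0 < c)%R &
  forall f : euclidean R d -> R, measurable_fun H f ->
   (forall z r, (0 <= r)%R -> (0 <= z.2)%R ->
     \int[nu]_(y in cube z r) abs_halfspace f y < +oo) ->
   forall t, (0 < t)%R -> nu (H `&` [set x | t%:E <
     maximal_function alpha f x]) <=
     (K / t)%:E * \int[nu]_(y in [set y | (c * t)%:E <
       abs_halfspace f y]) abs_halfspace f y].
Proof.
have [C C0 CP] := translation_ball_le d0 halpha.
have [D D0 DP] := weinstein_measure_doubling d halpha.
exists (D * (2 * C))%R, (2 * C)^-1%R.
split; [by rewrite !mulr_gt0|by rewrite invr_gt0 mulr_gt0|].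
move=> f mf floc t t0; rewrite [((_)^-1 * t)%R]mulrC.
set L := [set y | _ < abs_halfspace f y].
have mabs := measurable_abs_halfspace mf.
have mL : measurable L by rewrite -[X in measurable X]setTI;
  apply: measurable_lte.
have mh : measurable_fun setT (abs_halfspace f \_ L).
  by apply/(measurable_restrictT _ mL); exact: measurable_funTS.
have h0 y : 0 <= (abs_halfspace f \_ L) y by rewrite patchE;
  case: ifPn => // _; exact: abs_halfspace_ge0.
have [F [-> FP]] := maximal_function_superlevel d0 halpha mf floc t.
have mF n : measurable (F n) by have [] := FP n.
pose U n := \big[setU/set0]_(i < n.+1) F i.
have mU n : measurable (U n) by apply: bigsetU_measurable.
have UE : \bigcup_n F n = \bigcup_n U n by rewrite /U bigcup_bigsetU_bigcup.
have mUU : measurable (\bigcup_n U n) by apply: bigcupT_measurable.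
have Und : {homo U : n m / (n <= m)%N >-> (n <= m)%O}.
  by move=> n m nm; apply/subsetPset/subset_bigsetU.
rewrite UE -(cvg_lim _ (nondecreasing_cvg_mu mU mUU Und))//.
apply: lime_le.
  by apply/cvg_ex; eexists; exact: (nondecreasing_cvg_mu mU mUU Und).
apply: nearW => n.
have [s [Us sP]] : exists s : seq (euclidean R d * R), U n `<=` cubes s /\
    forall q, q \in s -> exceeding alpha f t q.2 q.1.
  rewrite /U; elim: n.+1 => [|m [s [Us sP]]].
    by exists [::]; split => //; rewrite big_ord0.
  rewrite big_ord_recr/=; have [_ [->|[e [z [ez Fz]]]]] := FP m.
    by rewrite setU0; exists s.
  exists ((z, e) :: s); split.
    move=> x [/Us[q qs xq]|/Fz xz]; last by exists (z, e) => //=;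
      rewrite inE eqxx.
    by exists q => //=; rewrite inE; apply/orP; right.
  by move=> q; rewrite inE => /predU1P[->//|/sP].
apply: (@le_trans _ _ (nu (cubes s))).
  by apply: le_measure; rewrite ?inE//; exact: measurable_cubes.
have K0 : (0 <= 2 * C / t)%R by rewrite divr_ge0 ?mulr_ge0 ?ltW.
have hD q : q \in s -> nu (cube q.1 (3 * q.2)) <= D%:E * nu (cube q.1 q.2).
  by move=> /sP[q0 z0 _]; apply: DP => //; exact: ltW.
have hK q : q \in s -> (0 <= q.2)%R /\
    nu (cube q.1 q.2) <= (2 * C / t)%:E * \int[nu]_(y in cube q.1 q.2)
      (abs_halfspace f \_ L) y.
  move=> /sP ex; have [q0 z0 _] := ex; split; first exact: ltW.
  apply: exceeding_truncated_cube_le => //.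
  by apply: floc; exact: ltW.
apply: le_trans (vitali_cubes mh h0 (ltW D0) K0 hD hK) _.
rewrite (_ : D * (2 * C) / t = D * (2 * C / t))%R; last by rewrite -mulrA.
apply: lee_wpmul2l.
  by rewrite lee_fin mulr_ge0// ltW.
rewrite [leRHS]integral_mkcond; apply: ge0_subset_integral => //.
exact: measurable_cubes.
Qed.

End weak_type.

(** * The strong type inequality *)

Section Lp.
Context {R : realType}.
Variables (d : nat) (alpha : R).
Hypothesis (d0 : (0 < d)%N) (halpha : - 2^-1 < alpha).
Implicit Types (x y z : euclidean R d) (r e t : R) (f : euclidean R d -> R).
Local Notation nu := (@weinstein_measure R d alpha).
Local Notation H := (@halfspace R d).
Local Open Scope ereal_scope.

Lemma weinstein_measure_sigma_finite : sigma_finite setT nu.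
Proof.
exists (fun n => cube (@origin R d) n%:R) => [|n]; last first.
  by split; [exact: measurable_cube|exact: weinstein_measure_cube_lty].
apply/seteqP; split => // x _.
pose M := (\sum_(i < d.-1) `|tnth x.1 i| + `|x.2|)%R.
have M0 : (0 <= \sum_(i < d.-1) `|tnth x.1 i|)%R by apply: sumr_ge0.
exists (Num.bound M) => //.
have MN : (M <= (Num.bound M)%:R)%R.
  by apply/ltW/(le_lt_trans (ler_norm _))/(lt_le_trans (archi_boundP
    (normr_ge0 _))); rewrite /Num.bound normr_id.
apply/cubeP; split => [i|]; apply: le_trans MN;
  rewrite /origin/= ?tnth_mktuple subr0 /M.
  rewrite (bigD1 i)//= -addrA lerDl addr_ge0//.
  by apply: sumr_ge0.
by rewrite lerDr.
Qed.

Lemma patch_EFin_absE f x : `|((fun x => (f x)%:E) \_ H) x| = abs_halfspace f x.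
Proof. by rewrite /abs_halfspace !patchE; case: ifPn. Qed.

Lemma measurable_patch (g : euclidean R d -> \bar R) :
  measurable_fun H g -> measurable_fun setT (g \_ H).
Proof. by move/(measurable_restrictT _ (@measurable_halfspace R d)). Qed.

Lemma weinstein_measure_setT_gt0 : 0 < nu setT.
Proof.
apply: (@lt_le_trans _ _ (nu (cube (@origin R d) 1))).
  exact: weinstein_measure_cube_gt0.
by apply: le_measure; rewrite ?inE//; exact: measurable_cube.
Qed.

Lemma weinstein_normyE (g : euclidean R d -> \bar R) :
  weinstein_norm alpha +oo g = ess_sup nu (abse \o (g \_ H)).
Proof. by rewrite /weinstein_norm unlock weinstein_measure_setT_gt0. Qed.

Lemma weinstein_norm_finE r (g : euclidean R d -> \bar R) :
  weinstein_norm alpha r%:E g = (\int[nu]_x (`|(g \_ H) x| `^ r)) `^ (r^-1).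
Proof. by rewrite /weinstein_norm unlock. Qed.

(** Cubes have finite measure, and |f| <= 1 + |f|^p if p is finite, while f is
    essentially bounded if p = +oo. *)
Lemma in_Lp_locally_integrable (p : \bar R) f : 1 < p ->
  in_Lp alpha p (fun x => (f x)%:E) ->
  forall z r, (0 <= r)%R -> (0 <= z.2)%R ->
    \int[nu]_(y in cube z r) abs_halfspace f y < +oo.
Proof.
move=> p1 [/measurable_EFinP mf fp] z r r0 z0.
have mQ := measurable_cube z r.
have mabs := measurable_abs_halfspace mf.
have Qfin := weinstein_measure_cube_lty halpha r0 z0.
case: p p1 fp => [p| |]//.
- rewrite lte_fin => p1; rewrite weinstein_norm_finE => fp.
  have p0 := lt_trans ltr01 p1.
  have If : \int[nu]_x (abs_halfspace f x `^ p) < +oo.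
    under eq_integral do rewrite -patch_EFin_absE.
    by apply: lty_poweRy fp; rewrite invr_eq0 gt_eqF.
  have map : measurable_fun setT (fun x => abs_halfspace f x `^ p).
    exact: (measurableT_comp (measurable_poweR _)).
  apply: (@le_lt_trans _ _ (\int[nu]_(y in cube z r)
    (1 + abs_halfspace f y `^ p))).
    apply: ge0_le_integral => //.
    - by move=> y _; exact: abs_halfspace_ge0.
    - exact: measurable_funTS.
    - by apply: emeasurable_funD => //; exact: measurable_funTS.
    - move=> y _; rewrite /abs_halfspace; set u := (f \_ H) y.
      rewrite abse_EFin poweR_EFin -EFinD lee_fin.
      have [u1|/ltW u1] := leP `|u|%R 1%R.
        by rewrite (le_trans u1)// lerDl powR_ge0.
      by rewrite (le_trans (le1r_powR u1 (ltW p1)))// lerDr.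
  rewrite ge0_integralD//; last 2 first.
  - by move=> y _; exact: poweR_ge0.
  - exact: measurable_funTS.
  rewrite integral_cst// mul1e lte_add_pinfty//; apply: le_lt_trans If.
  by apply: ge0_subset_integral => // y _; exact: poweR_ge0.
- move=> _; rewrite weinstein_normyE; set M := ess_sup _ _ => Mfin.
  have M0 : 0 <= M by rewrite /M -weinstein_normyE; exact: Lnorm_ge0.
  apply: (@le_lt_trans _ _ (\int[nu]_(y in cube z r) M)).
    apply: ae_ge0_le_integral => //.
    - by move=> y _; exact: abs_halfspace_ge0.
    - exact: measurable_funTS.
    - have := @ess_sup_ge _ _ _ nu (abse \o ((fun x => (f x)%:E) \_ H)).
      by apply: filterS => y /= + _; rewrite patch_EFin_absE.
  by rewrite integral_cst// lte_mul_pinfty// ge0_fin_numE.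
Qed.

(** A mean over a cube is at most the essential supremum. The bound holds at
    every point, and not only almost everywhere. *)
Lemma maximal_function_le_ess_sup : exists2 c : R, (0 < c)%R & forall f,
  in_Lp alpha +oo (fun x => (f x)%:E) ->
  forall x, maximal_function alpha f x <=
    c%:E * weinstein_norm alpha +oo (fun x => (f x)%:E).
Proof.
have [C C0 CP] := translation_ball_le d0 halpha.
exists C => // f Lf x; have [/measurable_EFinP mf] := Lf.
rewrite weinstein_normyE; set M := ess_sup _ _ => Mfin.
have M0 : 0 <= M by rewrite /M -weinstein_normyE; exact: Lnorm_ge0.
have Mnum : M \is a fin_num by rewrite ge0_fin_numE.
have floc := in_Lp_locally_integrable (ltry 1) Lf.
apply/lee_addgt0Pr => e e0; rewrite leNgt; apply/negP.
rewrite -(fineK Mnum) -EFinM -EFinD =>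
  /(maximal_function_gtP d0 halpha)[r [z [ex _]]].
have := exceeding_cube_le d0 halpha mf C0 CP ex; have [r0 z0 _] := ex.
apply/negP; rewrite -ltNge.
have Q0 := weinstein_measure_cube_gt0 halpha r0 (ltW z0).
have Qfin : nu (cube z r) \is a fin_num.
  by rewrite ge0_fin_numE ?measure_ge0// weinstein_measure_cube_lty// ltW.
have C0' : 0 <= C%:E by rewrite lee_fin ltW.
apply: (@le_lt_trans _ _ (C%:E * (M * nu (cube z r)))).
  rewrite lee_wpmul2l//.
  rewrite -integral_cst//; last exact: measurable_cube.
  apply: ae_ge0_le_integral => //.
  - exact: measurable_cube.
  - by move=> y _; exact: abs_halfspace_ge0.
  - by apply: measurable_funTS; exact: measurable_abs_halfspace.
  - have := @ess_sup_ge _ _ _ nu (abse \o ((fun x => (f x)%:E) \_ H)).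
    by apply: filterS => y /= + _; rewrite patch_EFin_absE.
rewrite -(fineK Mnum) -(fineK Qfin) -!EFinM lte_fin mulrA ltr_pM2r.
  by rewrite ltrDl.
by rewrite fine_gt0// Q0/= ltey_eq Qfin.
Qed.

Lemma maximal_function_strong_type r : (1 < r)%R ->
  exists2 c : R, (0 < c)%R & forall f,
  in_Lp alpha r%:E (fun x => (f x)%:E) ->
  weinstein_norm alpha r%:E (maximal_function alpha f) <=
  c%:E * weinstein_norm alpha r%:E (fun x => (f x)%:E).
Proof.
move=> r1; have r0 := lt_trans ltr01 r1.
have [K [c [K0 c0 weak]]] := maximal_weak_type d0 halpha.
pose A := (2 `^ r * K * (c `^ (1 - r) / (r - 1)))%R.
have A0 : (0 < A)%R.
  by rewrite /A !mulr_gt0 ?powR_gt0 ?invr_gt0 ?subr_gt0.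
exists (A `^ r^-1)%R; first exact: powR_gt0.
move=> f Lf; have [/measurable_EFinP mf _] := Lf.
have floc := in_Lp_locally_integrable (_ : 1 < r%:E) Lf.
have mM := measurable_maximal_function d0 halpha mf (floc r1).
pose nu' : {sigma_finite_measure set (euclidean R d) -> \bar R} := HB.pack nu
  (Measure_isSigmaFinite.Build _ _ _ nu weinstein_measure_sigma_finite).
have G0 x : 0 <= (maximal_function alpha f \_ H) x.
  by rewrite patchE; case: ifPn => // /set_mem; exact: maximal_function_ge0.
have mg : measurable_fun setT (fun x => `|(f \_ H) x|%R).
  apply: measurableT_comp => //.
  by move/(measurable_restrictT _ (@measurable_halfspace R d)): mf.
have h := @marcinkiewicz_le _ _ _ nu' (maximal_function alpha f \_ H)
  (fun x => `|(f \_ H) x|%R) K c r r1 K0 c0 (measurable_patch mM) mg G0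
  (fun x => normr_ge0 _).
have wk t : (0 < t)%R -> nu' [set x | t%:E <
  (maximal_function alpha f \_ H) x] <=
   (K / t)%:E * \int[nu']_(x in [set x | (c * t <
     `|(f \_ H) x|)%R]) (`|(f \_ H) x|%R)%:E.
  move=> t0; have := weak f mf (floc r1) t t0.
  congr (nu _ <= _); apply/seteqP; split => x /=; rewrite patchE.
    by move=> [Hx]; rewrite mem_set.
  by case: ifPn => [/set_mem//|_]; rewrite lte_fin ltNge (ltW t0).
have {}h := h wk.
rewrite !weinstein_norm_finE.
have E1 : \int[nu]_x (`|(maximal_function alpha f \_ H) x| `^ r) =
    \int[nu]_x ((maximal_function alpha f \_ H) x `^ r).
  by apply: eq_integral => x _; rewrite gee0_abs.
have E2 : \int[nu]_x (`|((fun x => (f x)%:E) \_ H) x| `^ r) =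
    \int[nu]_x ((`|(f \_ H) x|%R)%:E `^ r).
  by apply: eq_integral => x _; rewrite patch_EFin_absE.
have I0 (g : euclidean R d -> \bar R) : 0 <= \int[nu]_x (g x `^ r).
  by apply: integral_ge0 => x _; exact: poweR_ge0.
rewrite E1 E2 -poweR_EFin -poweRM ?lee_fin ?(ltW A0)//.
apply: gt0_ler_poweR => //; first by rewrite invr_ge0 ltW.
- by rewrite in_itv/= leey andbT I0.
- rewrite in_itv/= leey andbT mule_ge0 ?lee_fin ?(ltW A0)//.
  by apply: integral_ge0 => x _; rewrite lee_fin powR_ge0.
Qed.

End Lp.

Unset Implicit Arguments.

Theorem corollary3p1 (R : realType) (d : nat) (hd : (2 <= d)%N)
    (alpha : R) (halpha : - 2^-1 < alpha) (p : \bar R) (hp : (1 < p)%E) :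
  exists2 c : R, 0 < c &
    forall f : euclidean R d -> R,
      in_Lp alpha p (fun x => (f x)%:E) ->
      in_Lp alpha p (maximal_function alpha f) /\
      (weinstein_norm alpha p (maximal_function alpha f)
         <= c%:E * weinstein_norm alpha p (fun x => (f x)%:E))%E.
Proof.
have d0 : (0 < d)%N by exact: leq_trans hd.
suff [c c0 cP] : exists2 c : R, 0 < c & forall f : euclidean R d -> R,
      in_Lp alpha p (fun x => (f x)%:E) ->
      (weinstein_norm alpha p (maximal_function alpha f)
         <= c%:E * weinstein_norm alpha p (fun x => (f x)%:E))%E.
  exists c => // f Lf; have le := cP f Lf; split => //.
  have [/measurable_EFinP mf ffin] := Lf; split.
    exact: measurable_maximal_function (in_Lp_locally_integrable halpha hp Lf).
  apply: le_lt_trans le _; rewrite lte_mul_pinfty ?lee_fin ?ltW//.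
case: p hp => [r| |]//.
- by rewrite lte_fin => r1; exact: maximal_function_strong_type.
- move=> _; have [c c0 cP] := maximal_function_le_ess_sup d0 halpha.
  exists c => // f Lf; rewrite weinstein_normyE//; apply/ess_supP.
  have cN : (0 <= c%:E * weinstein_norm alpha +oo (fun x => (f x)%:E))%E.
    by rewrite mule_ge0 ?lee_fin ?(ltW c0)//; exact: Lnorm_ge0.
  apply: aeW => x /=; rewrite patchE; case: ifPn => [/set_mem Hx|_].
    by rewrite gee0_abs ?maximal_function_ge0//; exact: cP.
  by rewrite abse0.
Qed.
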